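(* Let $f\in\mathbb{Z}[u^{\pm1}]$ be an irreducible nonhyperbolic polynomial which is not cyclotomic, let $\alpha=\alpha_{R_1/(f)}$ be the ergodic and nonexpansive automorphism of the compact connected abelian group $X=X_{R_1/(f)}$, and let $\tilde\sigma:\tilde Y\to\tilde Y$ be the homeomorphism $\tilde\sigma(v,w)=(\bar\sigma v,\bar\sigma w+\mathsf{d}(1,v))$ of $\tilde Y=\ell^\infty(\mathbb{Z},\mathbb{Z})\times W_f^{(0)}$. For every $\bar\sigma$-invariant probability measure $\nu$ on $\ell^\infty(\mathbb{Z},\mathbb{Z})$ the following conditions are equivalent. (1) There exists a $\tilde\sigma$-invariant probability measure $\tilde\nu$ on $\tilde Y$ with $\tilde\pi_*\tilde\nu=\nu$, where $\tilde\pi:\tilde Y\to\ell^\infty(\mathbb{Z},\mathbb{Z})$ is the first coordinate projection. (2) For every $\varepsilon>0$ there exists a compact subset $C_\varepsilon\subset W_f^{(0)}$ with $\nu(\{v\in\ell^\infty(\mathbb{Z},\mathbb{Z}):\mathsf{d}(k,v)\in C_\varepsilon\})>1-\varepsilon$ for every $k\in\mathbb{Z}$. (3) There exists a Borel map $\mathsf{b}:\ell^\infty(\mathbb{Z},\mathbb{Z})\to W_f^{(0)}$ with $\mathsf{d}(1,v)=\mathsf{b}(\bar\sigma v)-\bar\sigma\mathsf{b}(v)$ for $\nu$-a.e. $v\in\ell^\infty(\mathbb{Z},\mathbb{Z})$. If $\nu$ satisfies these equivalent conditions (with $\mathsf{b}$ as in (3)), then the Borel map $\xi^*_{\mathsf{b}}:\ell^\infty(\mathbb{Z},\mathbb{Z})\to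 X$ defined by $\xi^*_{\mathsf{b}}(v)=\xi^*(v)+\rho(\mathsf{b}(v))$ for every $v\in\ell^\infty(\mathbb{Z},\mathbb{Z})$ satisfies $\xi^*_{\mathsf{b}}(v)-\xi^*(v)\in X^{(0)}$ for every $v\in\ell^\infty(\mathbb{Z},\mathbb{Z})$, and $\xi^*_{\mathsf{b}}\circ\bar\sigma=\alpha\circ\xi^*_{\mathsf{b}}$ $\nu$-a.e.; and the probability measure $\mu=(\xi^*_{\mathsf{b}})_*\nu$ on $X$ is $\alpha$-invariant.
   Context: Let $R_1=\mathbb{Z}[u^{\pm1}]$ and let $f=f_0+\dots+f_mu^m\in R_1$ be irreducible with $m>0$, $f_m>0$, $f_0\ne 0$. Let $\Omega_f\subset\mathbb{C}$ be its set of roots, and $\Omega_f^-$, $\Omega_f^{(0)}$, $\Omega_f^+$ the sets of roots of absolute value $<1$, $=1$, $>1$, respectively. The polynomial $f$ is nonhyperbolic if $\Omega_f^{(0)}\neq\varnothing$ and cyclotomic if $\Omega_f^{(0)}$ contains a root of unity. $\mathbb{T}=\mathbb{R}/\mathbb{Z}$, $X=X_{R_1/(f)}=\{x\in\mathbb{T}^{\mathbb{Z}}:\sum_{j=0}^m f_jx_{k+j}=0 \text{ for every } k\in\mathbb{Z}\}$, and $\alpha=\alpha_{R_1/(f)}$ is the restriction to $X$ of the shift $\tau(x)_n=x_{n+1}$. $\ell^\infty(\mathbb{Z},\mathbb{R})$ is the space of bounded real sequences, with the topology of coordinatewise convergence; $\ell^\infty(\mathbb{Z},\mathbb{Z})$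 is the subgroup of integer-valued sequences. The shift is $(\bar\sigma w)_n=w_{n+1}$, and $f(\bar\sigma)=\sum_{j=0}^m f_j\bar\sigma^j$. Put $W_f^{(0)}=\{w\in\ell^\infty(\mathbb{Z},\mathbb{R}): f(\bar\sigma)w=0\}$, a finite-dimensional real vector space (with its usual topology). Let $\rho$ be coordinatewise reduction mod $1$ of real sequences (defined on all real sequences), and $X^{(0)}=\rho(W_f^{(0)})\subset X$. Write $\frac1{f(u)}=\frac1{f_m}\sum_{\omega\in\Omega_f}\frac{b_\omega}{u-\omega}$ with $b_\omega\in\mathbb{C}$ and define $w^{\Delta_+},w^{\Delta_-}\in\ell^\infty(\mathbb{Z},\mathbb{R})$ by $w^{\Delta_+}_n=\frac1{f_m}\sum_{\omega\in\Omega_f^-}b_\omega\omega^{n-1}$ if $n\ge1$, $w^{\Delta_+}_n=-\frac1{f_m}\sum_{\omega\in\Omega_f^{(0)}\cup\Omega_f^+}b_\omega\omega^{n-1}$ if $n\le0$; $w^{\Delta_-}_n=\frac1{f_m}\sum_{\omega\in\Omega_f^-\cup\Omega_f^{(0)}}b_\omega\omega^{n-1}$ if $n\ge1$, $w^{\Delta_-}_n=-\frac1{f_m}\sum_{\omega\in\Omega_f^+}b_\omega\omega^{n-1}$ if $n\le0$. For $v\in\ell^\infty(\mathbb{Z},\mathbb{Z})$ put $\bar\xi^*(v)=\sum_{n\ge0}v_n\bar\sigma^{-n}w^{\Delta_-}+\sum_{n<0}v_n\bar\sigma^{-n}w^{\Delta_+}$ (coordinatewise convergent; a real sequence of at most linear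 growth, to which $\bar\sigma$ is extended by the same formula), and $\xi^*=\rho\circ\bar\xi^*:\ell^\infty(\mathbb{Z},\mathbb{Z})\to X$. For $n\in\mathbb{Z}$ put $\mathsf{d}(n,v)=\bar\sigma^n\bar\xi^*(v)-\bar\xi^*(\bar\sigma^nv)\in W_f^{(0)}$. *)

(* Defs.v *)
From HB Require Import structures.
From mathcomp Require Import all_boot all_order all_algebra complex.
From mathcomp Require Import generic_quotient fraction ring_quotient.
From mathcomp Require Import ring zify finmap.
From mathcomp Require Import all_classical all_reals all_analysis.
Import numFieldNormedType.Exports.
Import Order.TTheory GRing.Theory Num.Theory.

Set Implicit Arguments.
Unset Strict Implicit.
Unset Printing Implicit Defensive.

Local Open Scope classical_set_scope.
Local Open Scope ring_scope.

Section Laurent.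
Local Notation Q := {fraction {poly int}}.

(* Z[u^{+-1}], realised inside the fraction field of Z[u]. *)
Definition laurent : set Q :=
  [set x | exists p : {poly int}, exists k : nat, x = tofrac p / tofrac 'X^k].

Definition laurent_unit (x : Q) : Prop :=
  laurent x /\ exists2 y, laurent y & x * y = 1.

Definition laurent_irreducible (x : Q) : Prop :=
  [/\ laurent x, x != 0, ~ laurent_unit x
    & forall y z, laurent y -> laurent z -> x = y * z ->
        laurent_unit y \/ laurent_unit z].
End Laurent.

Notation borel T := (g_sigma_algebraType (@open T)).

Section Circle.
Variable R : realType.

Definition int_pred : {pred R} := fun x => x \is a Num.int.
Lemma int_pred_zmod : zmod_closed int_pred.
Proof. by split=> [|x y hx hy]; rewrite unfold_in ?rpred0// rpredB. Qed.
HB.instance Definition _ := GRing.isZmodClosed.Build R int_pred int_pred_zmod.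

Definition circle := quotient_topology (Quotient.quot int_pred).
HB.instance Definition _ := GRing.Zmodule.copy circle (Quotient.quot int_pred).
End Circle.

Section Sequences.
Variable V : zmodType.
Implicit Types (x : {ptws int -> V}) (f : {poly int}).

(* The k-th iterate of the shift, for k of any sign. *)
Definition sigma (k : int) x : {ptws int -> V} := fun n => x (n + k).

Definition f_sigma f x : {ptws int -> V} :=
  fun n => \sum_(j < size f) x (n + j%:Z) *~ f`_j.

Lemma f_sigma_zmod f : {morph f_sigma f : x y / x - y}.
Proof.
move=> x y; apply/funext => n.
transitivity (f_sigma f x n - f_sigma f y n) => //; rewrite /f_sigma -sumrB.
by apply: eq_bigr => j _; rewrite -mulrzBl.
Qed.

Lemma f_sigma0 f : f_sigma f 0 = 0.
Proof. by apply/funext => n; apply: big1 => j _; exact: mul0rz. Qed.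

Lemma f_sigma_sigma f k x : f_sigma f (sigma k x) = sigma k (f_sigma f x).
Proof.
by apply/funext => n; apply: eq_bigr => j _; rewrite /sigma addrAC.
Qed.
End Sequences.

Section BoundedSequences.
Variable R : realType.

Definition bounded_seq (w : {ptws int -> R}) : Prop :=
  exists M : R, forall n, `|w n| <= M.

Lemma bounded_seq_sigma k w : bounded_seq w -> bounded_seq (sigma k w).
Proof. by move=> [M hM]; exists M => n; exact: hM. Qed.

(* l^oo(Z,Z) is the subgroup of integer-valued elements of l^oo(Z,R), hence
   consists of sequences of real numbers. *)
Definition linfZ_pred : {pred {ptws int -> R}} :=
  fun v => `[< bounded_seq v /\ forall n, v n \is a Num.int >].

Lemma linfZ_zmod : zmod_closed linfZ_pred.
Proof.
split=> [|x y /asboolP[[M hM] xZ] /asboolP[[N hN] yZ]]; apply/asboolP.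
  by split=> [|n]; [exists 0 => n; rewrite normr0 | rewrite rpred0].
split=> [|n]; last by rewrite rpredB.
by exists (M + N) => n; rewrite (le_trans (ler_normB _ _))// lerD.
Qed.
HB.instance Definition _ :=
  GRing.isZmodClosed.Build {ptws int -> R} linfZ_pred linfZ_zmod.

Record linfZ := LinfZ { linfZ_val :> {ptws int -> R} ;
                        linfZP : linfZ_val \in linfZ_pred }.
HB.instance Definition _ := [isSub for linfZ_val].
HB.instance Definition _ := [Choice of linfZ by <:].
HB.instance Definition _ := [SubChoice_isSubZmodule of linfZ by <:].
HB.instance Definition _ := isPointed.Build linfZ 0.
HB.instance Definition _ :=
  Topological.copy linfZ (initial_topology linfZ_val).

Lemma linfZ_sigma k (v : linfZ) : sigma k v \in linfZ_pred.
Proof.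
have /asboolP[vb vZ] := linfZP v; apply/asboolP.
by split=> [|n]; [exact: bounded_seq_sigma | exact: vZ].
Qed.
Definition sigmaZ k (v : linfZ) : linfZ := LinfZ (linfZ_sigma k v).

Variable f : {poly int}.

(* As W_f^(0) is finite-dimensional, its usual topology is that of
   coordinatewise convergence. *)
Definition W0_pred : {pred {ptws int -> R}} :=
  fun w => `[< bounded_seq w /\ f_sigma f w = 0 >].

Lemma W0_zmod : zmod_closed W0_pred.
Proof.
split=> [|x y /asboolP[[M hM] fx] /asboolP[[N hN] fy]]; apply/asboolP.
  by split; [exists 0 => n; rewrite normr0 | exact: f_sigma0].
split; last by rewrite f_sigma_zmod fx fy subrr.
by exists (M + N) => n; rewrite (le_trans (ler_normB _ _))// lerD.
Qed.
HB.instance Definition _ :=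
  GRing.isZmodClosed.Build {ptws int -> R} W0_pred W0_zmod.

Record W0 := MkW0 { W0_val :> {ptws int -> R} ; W0P : W0_val \in W0_pred }.
HB.instance Definition _ := [isSub for W0_val].
HB.instance Definition _ := [Choice of W0 by <:].
HB.instance Definition _ := [SubChoice_isSubZmodule of W0 by <:].
HB.instance Definition _ := isPointed.Build W0 0.
HB.instance Definition _ := Topological.copy W0 (initial_topology W0_val).

Lemma W0_sigma k (w : W0) : sigma k w \in W0_pred.
Proof.
have /asboolP[wb wf] := W0P w; apply/asboolP.
by split; [exact: bounded_seq_sigma | rewrite f_sigma_sigma wf].
Qed.
Definition sigmaW k (w : W0) : W0 := MkW0 (W0_sigma k w).

Definition rho (w : {ptws int -> R}) : {ptws int -> circle R} :=
  fun n => \pi_(circle R)%qT (w n).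

Lemma f_sigma_rho w : f_sigma f (rho w) = rho (f_sigma f w).
Proof.
apply/funext => n; rewrite /rho /f_sigma raddf_sum.
by apply: eq_bigr => j _; rewrite raddfMz.
Qed.

Definition X_pred : {pred {ptws int -> circle R}} :=
  fun x => `[< f_sigma f x = 0 >].

Lemma X_zmod : zmod_closed X_pred.
Proof.
split=> [|x y /asboolP fx /asboolP fy]; apply/asboolP; first exact: f_sigma0.
by rewrite f_sigma_zmod fx fy subrr.
Qed.
HB.instance Definition _ :=
  GRing.isZmodClosed.Build {ptws int -> circle R} X_pred X_zmod.

Record X := MkX { X_val :> {ptws int -> circle R} ; XP : X_val \in X_pred }.
HB.instance Definition _ := [isSub for X_val].
HB.instance Definition _ := [Choice of X by <:].
HB.instance Definition _ := [SubChoice_isSubZmodule of X by <:].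
HB.instance Definition _ := isPointed.Build X 0.
HB.instance Definition _ := Topological.copy X (initial_topology X_val).

Lemma X_sigma (x : X) : sigma 1 x \in X_pred.
Proof. by have /asboolP fx := XP x; apply/asboolP; rewrite f_sigma_sigma fx. Qed.
Definition alpha (x : X) : X := MkX (X_sigma x).

Lemma rho_W0 (w : W0) : rho w \in X_pred.
Proof.
have /asboolP[_ fw] := W0P w; apply/asboolP; rewrite f_sigma_rho fw.
by apply/funext => n; exact: raddf0.
Qed.
Definition rhoW (w : W0) : X := MkX (rho_W0 w).

Definition X0 : set X := range rhoW.

End BoundedSequences.

Section Roots.
Variables (R : realType) (f : {poly int}).
Local Notation C := R[i].
Local Notation fC := (map_poly (fun c : int => c%:~R : C) f).

Definition Omega : set C := [set z | root fC z].
Definition Omega_m : set C := [set z | Omega z /\ `|z| < 1].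
Definition Omega_0 : set C := [set z | Omega z /\ `|z| = 1].
Definition Omega_p : set C := [set z | Omega z /\ 1 < `|z|].

Definition nonhyperbolic : Prop := Omega_0 !=set0.
Definition cyclotomic : Prop :=
  exists z n, [/\ Omega_0 z, (0 < n)%N & z ^+ n = 1].

(* Since C is infinite, this is the identity of rational functions; it
   determines b on Omega. *)
Definition partial_fractions (b : C -> C) : Prop :=
  forall u, ~ Omega u ->
    fC.[u]^-1 = (lead_coef fC)^-1 * \sum_(z \in Omega) b z / (u - z).

Variable b : C -> C.

Definition root_sum (A : set C) (n : int) : C :=
  (lead_coef fC)^-1 * \sum_(z \in A) b z * z ^ (n - 1).

(* The sums are real since the roots come in conjugate pairs: taking the real
   part is only a cast from C to R. *)
Definition w_plus : {ptws int -> R} := fun n =>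
  complex.Re (if 1 <= n then root_sum Omega_m n
              else - root_sum (Omega_0 `|` Omega_p) n).
Definition w_minus : {ptws int -> R} := fun n =>
  complex.Re (if 1 <= n then root_sum (Omega_m `|` Omega_0) n
              else - root_sum Omega_p n).

(* The second series runs over the negative indices -j-1, j >= 0. *)
Definition xibar (v : linfZ R) : {ptws int -> R} := fun k =>
  limn (series (fun j : nat => linfZ_val v j%:Z * sigma (- j%:Z) w_minus k))
  + limn (series (fun j : nat => linfZ_val v (- j.+1%:Z) * sigma j.+1%:Z w_plus k)).

End Roots.

(* The next three sections establish that d(n, v) is in W_f^(0) and xi^*(v) in X,
   as needed to give these maps their codomains. *)
Section AbsoluteConvergence.
Variable R : realType.
Local Notation C := R[i].

Lemma ReD (x y : C) : complex.Re (x + y) = complex.Re x + complex.Re y.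
Proof. by case: x y => [a c] [a' c']. Qed.
Lemma ReN (x : C) : complex.Re (- x) = - complex.Re x.
Proof. by case: x. Qed.
Lemma Re_sum (I : Type) (s : seq I) (F : I -> C) :
  complex.Re (\sum_(i <- s) F i) = \sum_(i <- s) complex.Re (F i).
Proof. exact: (big_morph _ ReD erefl). Qed.
Lemma ReMz (x : C) (n : int) : complex.Re (x *~ n) = complex.Re x *~ n.
Proof.
have h (m : nat) : complex.Re (x *+ m) = complex.Re x *+ m.
  by elim: m => [|m IH]//; rewrite !mulrS ReD IH.
by case: n => n; [exact: h | rewrite !NegzE !mulrNz ReN -!pmulrn h].
Qed.

Definition nC (z : C) : R := Num.sqrt (complex.Re z ^+ 2 + complex.Im z ^+ 2).
Lemma nCE z : `|z| = (nC z)%:C%C. Proof. exact: normc_def. Qed.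
Lemma nC_ge0 z : 0 <= nC z. Proof. exact: sqrtr_ge0. Qed.
Lemma nCM z w : nC (z * w) = nC z * nC w.
Proof. by have := normrM z w; rewrite !nCE -rmorphM => -[]. Qed.
Lemma nC1 : nC 1 = 1.
Proof. by have := normr1 C; rewrite !nCE => -[]. Qed.
Lemma nCX z n : nC (z ^+ n) = nC z ^+ n.
Proof. by elim: n => [|n IH]; rewrite ?expr0 ?nC1// !exprS nCM IH. Qed.
Lemma Re_nC z : `|complex.Re z| <= nC z.
Proof. by have := normc_ge_Re z; rewrite nCE lecR. Qed.
Lemma nC_lt1 z : (nC z < 1) = (`|z| < 1).
Proof. by rewrite nCE -ltcR. Qed.

Lemma series_rec (u : nat -> R) : cvgn (series (fun j => u j.+1)) ->
  cvgn (series u) /\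
  limn (series u) = u 0%N + limn (series (fun j => u j.+1)).
Proof.
move=> h.
have E : (fun n => series u n.+1) =
         (fun n => u 0%N + series (fun j => u j.+1) n).
  by apply/funext => n; rewrite /series /= big_nat_recl.
have c : series u @ \oo --> u 0%N + limn (series (fun j => u j.+1)).
  rewrite -(@cvg_shiftS _ (series u)) E.
  by apply: cvgD => //; exact: cvg_cst.
by split; [apply/cvg_ex; eexists; exact: c | exact/cvg_lim].
Qed.

Definition summ (u : nat -> R) := cvgn (series (fun n => `|u n|)).

Lemma summ_tail u : summ (fun j => u j.+1) -> summ u.
Proof. by move=> h; exact: (series_rec (u := fun n => `|u n|) h).1. Qed.

Lemma summ_tailn N u : summ (fun j => u (j + N)%N) -> summ u.
Proof.
elim: N u => [|N IH] u h; first by move: h; congr summ; apply/funext=> j; rewrite addn0.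
apply: IH; apply: summ_tail; move: h; congr summ; apply/funext=> j.
by rewrite addnS addSn.
Qed.

Lemma summ_le u w : (forall n, `|u n| <= `|w n|) -> summ w -> summ u.
Proof. by move=> h; apply: series_le_cvg. Qed.

Lemma summD u w : summ u -> summ w -> summ (fun n => u n + w n).
Proof.
move=> hu hw; apply: (@series_le_cvg _ _ (fun n => `|u n| + `|w n|)) => [n|n|n|].
- exact: normr_ge0.
- exact: addr_ge0.
- exact: ler_normD.
- exact: (is_cvg_seriesD hu hw).
Qed.

Lemma summ_bd (M : R) (c u : nat -> R) :
  (forall n, `|c n| <= M) -> summ u -> summ (fun n => c n * u n).
Proof.
move=> hc hu.
apply: (@series_le_cvg _ _ (fun n => M * `|u n|)) => [n|n|n|].
- exact: normr_ge0.
- by rewrite mulr_ge0// (le_trans _ (hc n)).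
- by rewrite normrM ler_wpM2r.
- rewrite (_ : series _ = (fun n => M * series (fun n => `|u n|) n)).
    by apply: is_cvgM => //; exact: is_cvg_cst.
  by apply/funext => n; rewrite /series /= mulr_sumr.
Qed.

Lemma summ_cvg u : summ u -> cvgn (series u).
Proof. exact: normed_cvg. Qed.

Lemma summ_geo (s : seq C) (c y : C -> C) :
  (forall z, z \in s -> `|y z| < 1) ->
  summ (fun j => complex.Re (\sum_(z <- s) c z * y z ^+ j)).
Proof.
elim: s => [|z s IH] h.
  rewrite /summ (_ : (fun n => _) = (fun _ => 0)).
    rewrite (_ : series _ = (fun _ => 0)); first exact: is_cvg_cst.
    by apply/funext => n; rewrite /series /= big1.
  by apply/funext => n; rewrite big_nil normr0.
have -> : (fun j => complex.Re (\sum_(z <- z :: s) c z * y z ^+ j)) =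
  (fun j => complex.Re (c z * y z ^+ j)
            + complex.Re (\sum_(z <- s) c z * y z ^+ j)).
  by apply/funext=> j; rewrite big_cons ReD.
apply: summD; last by apply: IH => t ts; apply: h; rewrite inE ts orbT.
apply: (@series_le_cvg _ _ (fun n => geometric (nC (c z)) (nC (y z)) n)) => [n|n|n|].
- exact: normr_ge0.
- by rewrite /= mulr_ge0 ?exprn_ge0 ?nC_ge0.
- by rewrite /= (le_trans (Re_nC _))// nCM nCX.
- apply: is_cvg_geometric_series; rewrite ger0_norm ?nC_ge0// nC_lt1.
  by apply: h; rewrite inE eqxx.
Qed.
End AbsoluteConvergence.

Section RootSums.
Variables (R : realType) (f : {poly int}).
Local Notation C := R[i].
Hypothesis f0 : f`_0 != 0.
Local Notation fC := (map_poly (fun c : int => c%:~R : C) f).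
Local Notation OmegaF := (@Omega R f).

Lemma coef_fC i : fC`_i = (f`_i)%:~R.
Proof. exact: coef_map_id0. Qed.

Lemma size_fC : size fC = size f.
Proof. by apply: size_map_inj_poly => //; exact: intr_inj. Qed.

Lemma fC_neq0 : fC != 0.
Proof.
by apply: contraNneq f0 => fC0; rewrite -(intr_eq0 C) -coef_fC fC0 coef0.
Qed.

Lemma Omega_finite : finite_set OmegaF.
Proof.
have [s Es] := closed_field_poly_normal fC.
apply: (@sub_finite_set _ _ [set` s]); last exact: finite_seq.
move=> z; rewrite /= /Omega /= Es rootZ ?lead_coef_eq0 ?fC_neq0//.
by rewrite root_prod_XsubC.
Qed.

Lemma Omega_neq0 z : OmegaF z -> z != 0.
Proof.
apply: contraPneq => ->; rewrite /Omega /= /root horner_coef0 coef_fC.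
by rewrite intr_eq0; exact/negP.
Qed.

Lemma horner_fC z : fC.[z] = \sum_(j < size f) (f`_j)%:~R * z ^+ j.
Proof.
by rewrite horner_coef size_fC; apply: eq_bigr => j _; rewrite coef_fC.
Qed.

Variable b : C -> C.
Local Notation S := (root_sum f b).
Local Notation lc := (lead_coef fC).

Lemma root_sumE A n : A `<=` OmegaF ->
  S A n = \sum_(z <- fset_set A) lc^-1 * b z * z ^ (n - 1).
Proof.
move=> AO; have Af : finite_set A := sub_finite_set AO Omega_finite.
rewrite /root_sum fsbig_finite// mulr_sumr.
by apply: eq_bigr => z _; rewrite mulrA.
Qed.

Lemma root_sumU A B n : A `<=` OmegaF -> B `<=` OmegaF -> A `&` B = set0 ->
  S (A `|` B) n = S A n + S B n.
Proof.
move=> AO BO AB0; rewrite /root_sum fsbigU0 ?mulrDr//.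
- exact: sub_finite_set AO Omega_finite.
- exact: sub_finite_set BO Omega_finite.
- by move=> z; rewrite AB0.
Qed.

Lemma root_sum_rec A n : A `<=` OmegaF -> f_sigma f (S A) n = 0.
Proof.
move=> AO; have Af : finite_set A := sub_finite_set AO Omega_finite.
rewrite /f_sigma; under eq_bigr do rewrite root_sumE// mulrz_suml.
rewrite exchange_big big_seq big1//= => z; rewrite in_fset_set// inE => Az.
have := AO _ Az; rewrite /Omega /= => /rootP fz.
transitivity (lc^-1 * b z * z ^ (n - 1) * fC.[z]); last by rewrite fz mulr0.
rewrite horner_fC mulr_sumr; apply: eq_bigr => j _.
rewrite -mulrzl addrAC expfzDr ?Omega_neq0//; last exact: AO.
by rewrite -exprnP; ring.
Qed.

Definition root_quo z : {poly C} := \poly_(i < size f)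
  \sum_(j < size f | (i < j)%N) (f`_j)%:~R * z ^+ (j - i.+1).

Lemma root_quo_eval z u : (u - z) * (root_quo z).[u] = fC.[u] - fC.[z].
Proof.
rewrite horner_poly !horner_fC -sumrB.
under [X in _ * X]eq_bigr do rewrite mulr_suml.
rewrite (exchange_big_dep xpredT)//= mulr_sumr; apply: eq_bigr => j _.
rewrite -mulrBr -(opprB z u) mulNr -[u ^+ j - _]opprB subrXX mulrN.
congr (- _); rewrite [RHS]mulrCA; congr (_ * _); rewrite mulr_sumr.
rewrite [RHS](big_ord_widen (size f)
  (fun i => (f`_j)%:~R * (z ^+ (j.-1 - i) * u ^+ i))) 1?ltnW//.
apply: eq_big => [i|i _]; first by [].
have -> : (j - i.+1 = j.-1 - i)%N by lia.
by rewrite mulrA.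
Qed.

Lemma poly_eval0 (p : {poly C}) : (forall u, p.[u] = 0) -> p = 0.
Proof.
move=> h; have : size (p + 1) == 1%N.
  apply: contraT => /closed_rootP[x]; rewrite /root hornerD h hornerC add0r.
  by rewrite oner_eq0.
move=> /eqP s1; have /size_poly1P[c _ pc] : size (p + 1) == 1%N by rewrite s1.
have pE : p = (c - 1)%:P by rewrite polyCB -pc addrK.
by rewrite pE -[c - 1](hornerC _ 0) -pE h.
Qed.

Hypothesis hb : partial_fractions f b.

Lemma root_quo_sum : \sum_(z <- fset_set OmegaF) (lc^-1 * b z) *: root_quo z = 1.
Proof.
apply/eqP; rewrite -subr_eq0 -(mulIr_eq0 _ (mulIf fC_neq0)); apply/eqP.
apply: poly_eval0 => u; rewrite hornerM.
have [Ou|Ou] := pselect (OmegaF u).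
  by move: (Ou); rewrite /Omega /= => /rootP ->; rewrite mulr0.
have u0 : fC.[u] != 0 by apply/negP => /eqP h; apply: Ou; apply/rootP.
rewrite hornerD hornerN hornerC horner_sum.
suff -> : \sum_(z <- fset_set OmegaF) ((lc^-1 * b z) *: root_quo z).[u] = 1.
  by rewrite subrr mul0r.
have := hb Ou; rewrite fsbig_finite ?mulr_sumr; last exact: Omega_finite.
move=> h; transitivity (fC.[u] * fC.[u]^-1); last by rewrite mulfV.
rewrite h mulr_sumr.
rewrite !big_seq; apply: eq_bigr => z.
rewrite in_fset_set ?inE; last exact: Omega_finite.
move=> Oz; have uz : u - z != 0.
  by rewrite subr_eq0; apply/eqP => uzE; apply: Ou; rewrite uzE.
have := root_quo_eval z u; move: (Oz); rewrite {1}/Omega /= => /rootP ->.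
rewrite subr0 => <-; rewrite hornerZ. field.
by rewrite uz lead_coef_eq0 fC_neq0.
Qed.

Lemma w_delta (A B : set C) n : A `|` B = OmegaF -> A `&` B = set0 ->
  f_sigma f (fun n => if 1 <= n then S A n else - S B n) n = (n == 0)%:R.
Proof.
move=> AB AB0.
have AO : A `<=` OmegaF by rewrite -AB; exact: subsetUl.
have BO : B `<=` OmegaF by rewrite -AB; exact: subsetUr.
have -> : f_sigma f (fun n => if 1 <= n then S A n else - S B n) n =
  \sum_(j < size f | 1 <= n + j%:Z) S OmegaF (n + j%:Z) *~ f`_j.
  rewrite -[RHS]subr0 -[X in _ = _ - X](root_sum_rec n BO) /f_sigma.
  rewrite [in RHS]big_mkcond -sumrB.
  apply: eq_bigr => j _; rewrite -AB; case: ifP => _.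
    by rewrite root_sumU// mulrzDl addrK.
  by rewrite sub0r mulNrz.
have [n0|n0] := ltP 0 n.
  rewrite gt_eqF//.
  transitivity (f_sigma f (S OmegaF) n); last exact: root_sum_rec.
  by apply: eq_bigl => j; lia.
have [i ->] : exists i : nat, n = - i%:Z.
  by exists `|n|%N; rewrite abszE ler0_norm// opprK.
rewrite oppr_eq0; have := congr1 (fun p : {poly C} => p`_i) root_quo_sum.
rewrite coef1 -[_ == 0]/(i == 0%N) => <-.
rewrite coef_sum; under eq_bigr do rewrite root_sumE// mulrz_suml.
rewrite exchange_big; apply: eq_bigr => z _.
rewrite coefZ coef_poly; case: ifPn => [ilt|ige]; last first.
  by rewrite big_pred0 ?mulr0// => j; have := ltn_ord j; lia.
rewrite mulr_sumr; apply: eq_big => [j|j ij]; first by lia.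
rewrite (_ : - i%:Z + j%:Z - 1 = (j - i.+1)%N); last by lia.
by rewrite -exprnP -mulrzl; ring.
Qed.
End RootSums.

Section Membership.
Variables (R : realType) (f : {poly int}).
Local Notation C := R[i].
Hypothesis f0 : f`_0 != 0.
Variable b : C -> C.
Local Notation fC := (map_poly (fun c : int => c%:~R : C) f).
Local Notation OmegaF := (@Omega R f).
Local Notation S := (root_sum f b).
Local Notation lc := (lead_coef fC).

Lemma nC_real (z : C) : `|z| \is Num.real. Proof. exact: normr_real. Qed.

Lemma sub_m : @Omega_m R f `<=` OmegaF. Proof. by move=> z []. Qed.
Lemma sub_0 : @Omega_0 R f `<=` OmegaF. Proof. by move=> z []. Qed.
Lemma sub_p : @Omega_p R f `<=` OmegaF. Proof. by move=> z []. Qed.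
Lemma sub_m0 : @Omega_m R f `|` @Omega_0 R f `<=` OmegaF.
Proof. by move=> z [] []. Qed.
Lemma sub_0p : @Omega_0 R f `|` @Omega_p R f `<=` OmegaF.
Proof. by move=> z [] []. Qed.
Lemma dis_m0 : @Omega_m R f `&` @Omega_0 R f = set0.
Proof. by apply/seteqP; split => // z [[_ h] [_ e]]; move: h; rewrite e ltxx. Qed.
Lemma dis_0p : @Omega_0 R f `&` @Omega_p R f = set0.
Proof. by apply/seteqP; split => // z [[_ e] [_]]; rewrite e ltxx. Qed.
Lemma dis_mp : @Omega_m R f `&` @Omega_p R f = set0.
Proof.
by apply/seteqP; split => // z [[_ /lt_trans h] [_ /h]]; rewrite ltxx.
Qed.

Lemma cover_m0p : @Omega_m R f `|` @Omega_0 R f `|` @Omega_p R f = OmegaF.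
Proof.
apply/seteqP; split => [z [[]|] []//|z Oz].
have [h|h|h] := real_ltgtP (nC_real z) (real1 C).
- by left; left.
- by right.
- by left; right.
Qed.

Lemma f_sigma_Re (x : {ptws int -> C}) n :
  f_sigma f (fun n => complex.Re (x n)) n = complex.Re (f_sigma f x n).
Proof. by rewrite /f_sigma Re_sum; apply: eq_bigr => j _; rewrite ReMz. Qed.

Lemma w_plus_delta n : partial_fractions f b ->
  f_sigma f (w_plus f b) n = (n == 0)%:R.
Proof.
move=> hb; rewrite /w_plus f_sigma_Re (w_delta f0 hb).
- by case: (n == 0).
- by rewrite setUA cover_m0p.
- by rewrite setIUr dis_m0 dis_mp setU0.
Qed.

Lemma w_minus_delta n : partial_fractions f b ->
  f_sigma f (w_minus f b) n = (n == 0)%:R.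
Proof.
move=> hb; rewrite /w_minus f_sigma_Re (w_delta f0 hb).
- by case: (n == 0).
- by rewrite cover_m0p.
- by rewrite setIUl dis_0p dis_mp setU0.
Qed.

Lemma w_sub n :
  w_minus f b n - w_plus f b n = complex.Re (S (@Omega_0 R f) n).
Proof.
rewrite /w_minus /w_plus -ReN -ReD; case: ifP => _; congr complex.Re.
  rewrite (root_sumU f0 b n sub_m sub_0 dis_m0); ring.
rewrite (root_sumU f0 b n sub_0 sub_p dis_0p); ring.
Qed.

Lemma w_plus_summ k : summ (fun j : nat => w_plus f b (k + j%:Z)).
Proof.
apply: (@summ_tailn _ `|k|.+1%N).
set A := @Omega_m R f.
have Af : finite_set A := sub_finite_set sub_m (Omega_finite R f0).
pose c (z : C) := lc^-1 * b z * z ^ (k + `|k|%:Z).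
have : summ (fun j =>
    complex.Re (\sum_(z <- fset_set A) c z * z ^+ j)).
  by apply: summ_geo => z; rewrite in_fset_set// inE => -[].
congr summ; apply/funext => j; rewrite /w_plus.
rewrite ifT; last by lia.
rewrite root_sumE//; last exact: sub_m.
congr complex.Re; rewrite !big_seq; apply: eq_bigr => z.
rewrite in_fset_set// inE => -[Oz _].
rewrite /c -[LHS]mulrA; congr (_ * _).
by rewrite exprnP -expfzDr ?(Omega_neq0 f0)//; congr (_ ^ _); lia.
Qed.

Lemma w_minus_summ k : summ (fun j : nat => w_minus f b (k - j%:Z)).
Proof.
apply: (@summ_tailn _ `|k|%N).
set A := @Omega_p R f.
have Af : finite_set A := sub_finite_set sub_p (Omega_finite R f0).
pose c (z : C) := - (lc^-1 * b z * z ^ (k - `|k|%:Z - 1)).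
have : summ (fun j =>
    complex.Re (\sum_(z <- fset_set A) c z * z^-1 ^+ j)).
  apply: summ_geo => z; rewrite in_fset_set// inE => -[_ z1].
  by rewrite normfV invf_lt1// (lt_trans ltr01).
congr summ; apply/funext => j; rewrite /w_minus.
rewrite ifF; last by lia.
rewrite root_sumE//; last exact: sub_p.
rewrite -sumrN.
congr complex.Re; rewrite !big_seq; apply: eq_bigr => z.
rewrite in_fset_set// inE => -[Oz _].
rewrite /c mulNr -[X in - X = _]mulrA; congr (- (_ * _)).
rewrite exprVn exprnN -expfzDr ?(Omega_neq0 f0)//; congr (_ ^ _); lia.
Qed.

Definition tm (v : linfZ R) k := fun j : nat =>
  linfZ_val v j%:Z * sigma (- j%:Z) (w_minus f b) k.
Definition tp (v : linfZ R) k := fun j : nat =>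
  linfZ_val v (- j.+1%:Z) * sigma j.+1%:Z (w_plus f b) k.

Lemma xibarE v k : xibar f b v k = limn (series (tm v k)) + limn (series (tp v k)).
Proof. by []. Qed.

Lemma tm_cvg v k : cvgn (series (tm v k)).
Proof.
have /asboolP[[M hM] _] := linfZP v.
apply: summ_cvg; apply: (@summ_bd _ M) => [n|]; first exact: hM.
exact: w_minus_summ.
Qed.

Lemma tp_cvg v k : cvgn (series (tp v k)).
Proof.
have /asboolP[[M hM] _] := linfZP v.
apply: summ_cvg; apply: (@summ_bd _ M) => [n|]; first exact: hM.
rewrite (_ : (fun _ => _) = (fun j : nat => w_plus f b (k + 1 + j%:Z))).
  exact: w_plus_summ.
by apply/funext => j; rewrite /sigma; congr w_plus; lia.
Qed.

Lemma xibar_sigma1 v k : xibar f b v (k + 1) - xibar f b (sigmaZ 1 v) k =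
  linfZ_val v 0 * complex.Re (S (@Omega_0 R f) (k + 1)).
Proof.
have Em : (fun j => tm v (k + 1) j.+1) = tm (sigmaZ 1 v) k.
  apply/funext => j; rewrite /tm /= /sigma.
  by congr (linfZ_val v _ * w_minus f b _); lia.
have Ep : (fun j => tp (sigmaZ 1 v) k j.+1) = tp v (k + 1).
  apply/funext => j; rewrite /tp /= /sigma.
  by congr (linfZ_val v _ * w_plus f b _); lia.
rewrite !xibarE.
have [_ ->] := @series_rec _ (tm v (k + 1)) ltac:(rewrite Em; exact: tm_cvg).
have [_ ->] := @series_rec _ (tp (sigmaZ 1 v) k) ltac:(rewrite Ep; exact: tp_cvg).
rewrite Em Ep -w_sub /tm /tp /= /sigma oppr0 addr0 addNr; ring.
Qed.

Lemma root_sum0_W0 : (fun k => complex.Re (S (@Omega_0 R f) (k + 1))) \in @W0_pred R f.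
Proof.
apply/asboolP; split.
  exists (\sum_(z <- fset_set (@Omega_0 R f)) nC (lc^-1 * b z)) => k.
  rewrite root_sumE//; last exact: sub_0.
  rewrite Re_sum (le_trans (ler_norm_sum _ _ _))// !big_seq.
  have Af := sub_finite_set sub_0 (Omega_finite R f0).
  apply: ler_sum => z; rewrite in_fset_set// inE => -[Oz z1].
  rewrite (le_trans (Re_nC _))// nCM -[leRHS]mulr1 ler_wpM2l ?nC_ge0//.
  rewrite -lecR -nCE; case: (k + 1 - 1) => m.
    by rewrite -exprnP normrX z1 expr1n.
  by rewrite NegzE -exprnN normrV ?unitfE ?expf_neq0 ?(Omega_neq0 f0)// normrX z1 expr1n invr1.
apply/funext => n.
rewrite -[LHS]/(f_sigma f (sigma 1 (fun k => complex.Re (S (@Omega_0 R f) k))) n).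
by rewrite f_sigma_sigma /sigma f_sigma_Re root_sum_rec//; exact: sub_0.
Qed.

Definition d_seq n (v : linfZ R) : {ptws int -> R} :=
  sigma n (xibar f b v) - xibar f b (sigmaZ n v).

Lemma W0Z (a : R) w : w \in @W0_pred R f -> (fun n => a * w n) \in @W0_pred R f.
Proof.
move=> /asboolP[[M hM] fw]; apply/asboolP; split.
  by exists (`|a| * M) => n; rewrite normrM ler_wpM2l.
apply/funext => n; transitivity (a * f_sigma f w n); last by rewrite fw mulr0.
by rewrite /f_sigma mulr_sumr; apply: eq_bigr => j _; rewrite mulrzAr.
Qed.

Lemma sigmaZA m n (v : linfZ R) : sigmaZ m (sigmaZ n v) = sigmaZ (m + n) v.
Proof. by apply/val_inj/funext => k; rewrite /= /sigma addrA. Qed.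
Lemma sigmaZ0 (v : linfZ R) : sigmaZ 0 v = v.
Proof. by apply/val_inj/funext => k; rewrite /= /sigma addr0. Qed.

Lemma d_seqD m n v : d_seq (m + n) v = sigma n (d_seq m v) + d_seq n (sigmaZ m v).
Proof.
apply/funext => k; rewrite /d_seq sigmaZA.
change (xibar f b v (k + (m + n)) - xibar f b (sigmaZ (m + n) v) k =
  xibar f b v (k + n + m) - xibar f b (sigmaZ m v) (k + n)
  + (xibar f b (sigmaZ m v) (k + n) - xibar f b (sigmaZ (n + m) v) k)).
by rewrite [RHS]addrA subrK -[k + n + m]addrA ![n + m]addrC.
Qed.

Lemma d_seq1_W0 v : d_seq 1 v \in @W0_pred R f.
Proof.
rewrite (_ : d_seq 1 v = (fun k => linfZ_val v 0 *
  complex.Re (S (@Omega_0 R f) (k + 1)))); first exact/W0Z/root_sum0_W0.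
by apply/funext => k; exact: xibar_sigma1.
Qed.

Lemma W0_pred_sigma n w : w \in @W0_pred R f -> sigma n w \in @W0_pred R f.
Proof. by move=> h; exact: (W0_sigma n (MkW0 h)). Qed.

Lemma d_seq0 v : d_seq 0 v = 0.
Proof.
by apply/funext => k; rewrite /d_seq sigmaZ0 -[LHS]/(_ - _) /sigma addr0 subrr.
Qed.

Lemma d_seq_W0 n v : d_seq n v \in @W0_pred R f.
Proof.
have pos m : forall v, d_seq m%:Z v \in @W0_pred R f.
  elim: m => [|m IH] u; first by rewrite d_seq0 rpred0.
  by rewrite -addn1 PoszD d_seqD rpredD ?d_seq1_W0// W0_pred_sigma.
case: n => [m|m]; first exact: pos.
rewrite NegzE; have := d_seqD (- m.+1%:Z) m.+1%:Z v.
rewrite addNr d_seq0 => /esym/eqP; rewrite addr_eq0 => /eqP h.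
have -> : d_seq (- m.+1%:Z) v =
    sigma (- m.+1%:Z) (- d_seq m.+1%:Z (sigmaZ (- m.+1%:Z) v)).
  by rewrite -h; apply/funext => k; rewrite /sigma subrK.
by apply: W0_pred_sigma; rewrite rpredN; exact: pos.
Qed.

Lemma cvg_delta (a : nat -> R) (m : nat) :
  series (fun j => a j * (m == j)%:R) @ \oo --> a m.
Proof.
apply: cvg_near_cst; exists m.+1 => [//|N /= mN].
rewrite /series /= big_mkord (bigD1 (Ordinal mN))//= eqxx mulr1 big1 => [|j].
  by rewrite addr0.
rewrite -val_eqE /= => jm; by rewrite eq_sym (negbTE jm) mulr0.
Qed.

Lemma cvg_sumMz (m : nat) (u : 'I_m -> nat -> R) (l : 'I_m -> R)
    (c : 'I_m -> int) : (forall i, u i @ \oo --> l i) ->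
  (fun N => \sum_(i < m) u i N *~ c i) @ \oo --> \sum_(i < m) l i *~ c i.
Proof.
move=> h; elim: (index_enum _) => [|i s IH].
  by rewrite big_nil; under eq_fun do rewrite big_nil; exact: cvg_cst.
rewrite big_cons; under eq_fun do rewrite big_cons.
apply: cvgD => //; rewrite -mulrzr; under eq_fun do rewrite -mulrzr.
exact: cvgMr_tmp.
Qed.

Lemma f_sigma_xibar v n : partial_fractions f b ->
  f_sigma f (xibar f b v) n = linfZ_val v n.
Proof.
move=> hb; rewrite /f_sigma.
have cm : series (fun j => \sum_(i < size f) tm v (n + i%:Z) j *~ f`_i) @ \oo -->
  \sum_(i < size f) limn (series (tm v (n + i%:Z))) *~ f`_i.
  rewrite (_ : series _ = (fun N => \sum_(i < size f) series (tm v (n + i%:Z)) N *~ f`_i)).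
    by apply: cvg_sumMz => i; exact: tm_cvg.
  apply/funext => N; rewrite /series /= exchange_big; apply: eq_bigr => i _.
  by rewrite mulrz_suml.
have cp : series (fun j => \sum_(i < size f) tp v (n + i%:Z) j *~ f`_i) @ \oo -->
  \sum_(i < size f) limn (series (tp v (n + i%:Z))) *~ f`_i.
  rewrite (_ : series _ = (fun N => \sum_(i < size f) series (tp v (n + i%:Z)) N *~ f`_i)).
    by apply: cvg_sumMz => i; exact: tp_cvg.
  apply/funext => N; rewrite /series /= exchange_big; apply: eq_bigr => i _.
  by rewrite mulrz_suml.
under eq_bigr do rewrite xibarE mulrzDl.
rewrite big_split /=.
have Em : (fun j => \sum_(i < size f) tm v (n + i%:Z) j *~ f`_i) =
  (fun j : nat => linfZ_val v j%:Z * (n == j%:Z)%:R).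
  apply/funext => j; rewrite -subr_eq0 -(w_minus_delta _ hb) /f_sigma mulr_sumr.
  apply: eq_bigr => i _; rewrite /tm /sigma mulrzAr.
  by congr (_ * w_minus f b _ *~ _); lia.
have Ep : (fun j => \sum_(i < size f) tp v (n + i%:Z) j *~ f`_i) =
  (fun j : nat => linfZ_val v (- j.+1%:Z) * (n == - j.+1%:Z)%:R).
  apply/funext => j; rewrite -addr_eq0 -(w_plus_delta _ hb) /f_sigma mulr_sumr.
  apply: eq_bigr => i _; rewrite /tp /sigma mulrzAr.
  by congr (_ * w_plus f b _ *~ _); lia.
rewrite Em in cm; rewrite Ep in cp.
rewrite -(cvg_lim _ cm)// -(cvg_lim _ cp)//.
case: n {cm cp Em Ep} => m.
  rewrite (cvg_lim _ (@cvg_delta (fun j => linfZ_val v j%:Z) m))//.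
  rewrite (_ : series _ = (fun=> 0)) ?lim_cst ?addr0//.
  by apply/funext => N; rewrite /series /= big1// => j _; rewrite mulr0.
rewrite [X in X + _](_ : _ = 0) ?add0r.
  by rewrite (cvg_lim _ (@cvg_delta (fun j => linfZ_val v (- j.+1%:Z)) m)).
rewrite (_ : series _ = (fun=> 0)) ?lim_cst//.
by apply/funext => N; rewrite /series /= big1// => j _; rewrite mulr0.
Qed.

Lemma rho_xibar v : partial_fractions f b -> rho (xibar f b v) \in @X_pred R f.
Proof.
move=> hb; apply/asboolP; rewrite f_sigma_rho; apply/funext => n.
rewrite /rho f_sigma_xibar// -[RHS](raddf0 (\pi_(circle R)%qT : {additive R -> circle R})).
have /asboolP[_ vZ] := linfZP v.
by apply/eqP; rewrite -Quotient.idealrBE subr0; exact: vZ.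
Qed.
End Membership.

Section Cocycle.
Variables (R : realType) (f : {poly int}) (f0 : f`_0 != 0).
Variable b : R[i] -> R[i].

Definition dcocycle (n : int) (v : linfZ R) : W0 R f :=
  MkW0 (d_seq_W0 f0 b n v).

Definition sigma_tilde (y : linfZ R * W0 R f) : linfZ R * W0 R f :=
  (sigmaZ 1 y.1, sigmaW 1 y.2 + dcocycle 1 y.1).

Definition xi (hb : partial_fractions f b) (v : linfZ R) : X R f :=
  MkX (rho_xibar f0 v hb).

End Cocycle.

Section Measures.
Variable R : realType.

Definition measure_invariant d (T : measurableType d) (mu : probability T R)
    (g : T -> T) : Prop :=
  forall A, measurable A -> mu (g @^-1` A) = mu A.

Definition pushes_to d d' (T : measurableType d) (T' : measurableType d')
    (mu : probability T R) (nu : probability T' R) (g : T -> T') : Prop :=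
  forall A, measurable A -> nu A = mu (g @^-1` A).
End Measures.

(* Main.v *)
From HB Require Import structures.
Require Import Defs.
From mathcomp Require Import all_boot all_order all_algebra complex.
From mathcomp Require Import fraction finmap zify ring lra.
From mathcomp Require Import all_classical all_reals all_analysis measurable_realfun.
Import Order.TTheory GRing.Theory Num.Theory.
Import numFieldNormedType.Exports.

(** The three conditions form a cycle: lift => tightness => coboundary => lift.

A measure on the product that lifts [nu] makes the cocycle tight, because the
sup-norm balls of the space [W0] are compact and invariant under the shift, and
the value of the cocycle at time [k] over [v] is the difference between the
second coordinate of the [k]-th iterate of [sigma_tilde] at [(v, w)] and the
shift of [w]; both stay in one ball with high probability.  Conversely, when
the cocycle is the coboundary of [b], the graph of [b] is invariant under
[sigma_tilde] and the image of [nu] on it is the required lift.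

The substance is that a tight cocycle is a coboundary.  The elements of [W0] are
real combinations of the geometric progressions of the roots [z] of modulus
one.  The functional [root_coord z], whose coefficients are those of f/(u - z),
turns the shift into multiplication by [z] and turns the cocycle at time [n]
into [z ^+ n] times the sum over j < n of [z ^- (j + 1) * v_j].  This reduces
the question to one complex number at a time: [tight_twisted_coboundary] says
that, for a measure-preserving [S], a real function [phi] and a number [w] of
modulus one, if the sums [e_n x] over j < n of [w ^- (j + 1) * phi (S^j x)] are
tight, then [phi = beta \o S - w * beta] almost everywhere for a measurable
[beta].

For this, observe that [e_{k+1} x = e_1 x + w^-1 * e_k (S x)], so the planar
sequence of [S x] is the image of the shifted sequence of [x] under the
isometry [c |-> w * (c - e_1 x)].  It suffices to attach to almost every [x] a
point of the plane which depends measurably on the sequence, does not change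
when finitely many terms do, and moves along with isometries: its opposite is
[beta].  Tightness only speaks of one time after the other, but a maximal
inequality ([maximal_inequality], from the combinatorial covering argument
[count_visits_le]) shows that almost every sequence spends at least three
quarters of every initial time segment in some disc.  Consider then the points
[c] such that, for most times, the sequence is closer to [c] than [M], where
[M] is the least integer for which such points exist.  They form a nonempty
open set, which is bounded because two sets of most times always meet, and the
Chebyshev center of this set (the center of the smallest disc around it) is the
point that we want.

Borel measurability is checked on coordinates throughout: each space at hand
has a topology given by countably many real coordinates, or, for [X], is
reached by a continuous map from such a space. *)

Local Open Scope classical_set_scope.
Local Open Scope ring_scope.

Set Implicit Arguments.
Unset Strict Implicit.
Unset Printing Implicit Defensive.

(** * Measurable predicates and complex-valued functions *)

Section MeasurablePredicates.
Context d (T : measurableType d).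

Lemma measurable_exists (I : countType) (A : I -> set T) :
  (forall i, measurable (A i)) -> measurable [set x | exists i, A i x].
Proof.
move=> mA; rewrite (_ : mkset _ = \bigcup_(i in [set: I]) A i).
  by apply: countable_bigcupT_measurable => //; exact: countableP.
by apply/seteqP; split=> x [j]; exists j.
Qed.

Lemma measurable_forall (I : countType) (A : I -> set T) :
  (forall i, measurable (A i)) -> measurable [set x | forall i, A i x].
Proof.
move=> mA; rewrite (_ : mkset _ = ~` [set x | exists i, ~ A i x]).
  by apply: measurableC; apply: measurable_exists => i; exact: measurableC.
apply/seteqP; split=> [x /= Ax [j]|x /= h i]; first exact.
by apply: contrapT => nA; apply: h; exists i.
Qed.

Lemma measurable_imply (A B : set T) : measurable A -> measurable B ->
  measurable [set x | A x -> B x].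
Proof.
move=> mA mB; rewrite (_ : mkset _ = ~` A `|` B).
  by apply: measurableU => //; exact: measurableC.
apply/seteqP; split=> [x /= h|x [nA Ax|Bx _]//].
by have [/h|] := pselect (A x); [right|left].
Qed.

Lemma measurable_constant (Q : Prop) : measurable [set x : T | Q].
Proof.
have [q|nq] := pselect Q.
  by rewrite (_ : mkset _ = setT)// predeqE.
by rewrite (_ : mkset _ = set0)// predeqE.
Qed.

(** Being a statement on finitely many truth values, it can be decided one index
    at a time. *)
Lemma measurable_count (a : nat -> T -> bool) (m : nat) (Q : pred nat) :
  (forall k, measurable [set x | a k x]) ->
  measurable [set x | Q (\sum_(k < m) a k x)%N].
Proof.
move=> ma; elim: m Q => [|m IH] Q.
  under eq_set do rewrite big_ord0.
  by case: (Q 0%N); [rewrite (_ : mkset _ = setT)|rewrite (_ : mkset _ = set0)];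
     rewrite ?predeqE.
rewrite (_ : mkset _ =
    ([set x | a m x] `&` [set x | Q (\sum_(k < m) a k x).+1%N]) `|`
    (~` [set x | a m x] `&` [set x | Q (\sum_(k < m) a k x)%N])).
  apply: measurableU; apply: measurableI; [exact: ma| |exact/measurableC/ma|].
    exact: (IH (fun n => Q n.+1)).
  exact: IH.
apply/seteqP; split=> x; rewrite /= big_ord_recr /=.
  case E: (a m x) => /=; first by rewrite addn1 => h; left; split.
  by rewrite addn0 => h; right; split.
by case=> -[]; [move=> -> /=; rewrite addn1|move/negP/negbTE => -> /=; rewrite addn0].
Qed.
End MeasurablePredicates.

Section ComplexModulus.
Variable R : realType.
Local Notation C := R[i].
Implicit Types x y z : C.

Lemma nC_D x y : nC (x + y) <= nC x + nC y.
Proof. by have := ler_normD x y; rewrite !nCE -rmorphD lecR. Qed.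
Lemma nC_N x : nC (- x) = nC x.
Proof. by have := normrN x; rewrite !nCE => -[]. Qed.
Lemma nC_B x y : nC (x - y) <= nC x + nC y.
Proof. by rewrite -(nC_N y) nC_D. Qed.
Lemma nC_distC x y : nC (x - y) = nC (y - x).
Proof. by rewrite -nC_N opprB. Qed.
Lemma nC_0 : nC (0 : C) = 0.
Proof. by have := normr0 C; rewrite nCE => -[]. Qed.
Lemma nC_V x : nC x^-1 = (nC x)^-1.
Proof.
have [->|x0] := eqVneq x 0; first by rewrite invr0 nC_0 invr0.
have h : nC x * nC x^-1 = 1 by rewrite -nCM mulfV// nC1.
have n0 : nC x != 0 by apply: contra_eq_neq h => ->; rewrite mul0r eq_sym oner_eq0.
by apply: (mulfI n0); rewrite h mulfV.
Qed.
Lemma nC_sum n (F : 'I_n -> C) : nC (\sum_(i < n) F i) <= \sum_(i < n) nC (F i).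
Proof.
elim/big_ind2 : _ => [|x1 x2 y1 y2 h1 h2|//]; first by rewrite nC_0.
by rewrite (le_trans (nC_D _ _))// lerD.
Qed.
End ComplexModulus.

Section ComplexMeasurable.
Context d (T : measurableType d) (R : realType).
Local Notation C := R[i].

Definition measurable_complex (f : T -> C) :=
  measurable_fun setT (fun x => complex.Re (f x)) /\
  measurable_fun setT (fun x => complex.Im (f x)).

Lemma measurable_complex_cst (c : C) : measurable_complex (fun=> c).
Proof. by split; exact: measurable_cst. Qed.

Lemma measurable_complexD (f g : T -> C) : measurable_complex f ->
  measurable_complex g -> measurable_complex (fun x => f x + g x).
Proof.
move=> [f1 f2] [g1 g2]; split.
  rewrite (_ : (fun _ => _) = (fun x => complex.Re (f x) + complex.Re (g x))).
    exact: measurable_funD.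
  by apply/funext => x; rewrite raddfD.
rewrite (_ : (fun _ => _) = (fun x => complex.Im (f x) + complex.Im (g x))).
  exact: measurable_funD.
by apply/funext => x; rewrite raddfD.
Qed.

Lemma measurable_complexM (f g : T -> C) : measurable_complex f ->
  measurable_complex g -> measurable_complex (fun x => f x * g x).
Proof.
move=> [f1 f2] [g1 g2]; split.
  rewrite (_ : (fun _ => _) = (fun x => complex.Re (f x) * complex.Re (g x)
     - complex.Im (f x) * complex.Im (g x))).
    by apply: measurable_funB; exact: measurable_funM.
  by apply/funext => x; case: (f x); case: (g x).
rewrite (_ : (fun _ => _) = (fun x => complex.Re (f x) * complex.Im (g x)
     + complex.Im (f x) * complex.Re (g x))).
  by apply: measurable_funD; exact: measurable_funM.
by apply/funext => x; case: (f x); case: (g x).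
Qed.

Lemma measurable_complex_sum (I : Type) (s : seq I) (f : I -> T -> C) :
  (forall i, measurable_complex (f i)) ->
  measurable_complex (fun x => \sum_(i <- s) f i x).
Proof.
move=> mf; elim: s => [|i s IH].
  by under eq_fun do rewrite big_nil; exact: measurable_complex_cst.
by under eq_fun do rewrite big_cons; exact: measurable_complexD.
Qed.

Lemma measurable_nC (f : T -> C) : measurable_complex f ->
  measurable_fun setT (fun x => nC (f x)).
Proof.
move=> [f1 f2]; apply: (measurableT_comp (f := @Num.sqrt R)).
  by apply: continuous_measurable_fun; exact: sqrt_continuous.
by apply: measurable_funD; exact: measurable_funX.
Qed.

Lemma measurable_lt_nC (f : T -> C) (s : R) : measurable_complex f ->
  measurable [set x | s < nC (f x)].
Proof.
move=> mf; have := measurable_fun_ltr (measurable_cst s) (measurable_nC mf).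
by move=> /(_ measurableT [set true] I); rewrite setTI.
Qed.
End ComplexMeasurable.

(** * A maximal inequality for tight sums *)

(** A covering argument: call [k] bad if the visits to [a] take up more than a
    [q]-th of a segment of length at most [n] that starts at [k].  Scanning from
    the left, skip good times, and at a bad time jump over such a segment; the
    segments are disjoint, cover all bad times, and each of them has fewer bad
    times than [q] times its visits. *)
Lemma count_visits_le (q n N : nat) (a : nat -> bool) :
  (\sum_(k < N) [exists m : 'I_n.+1, m < q * \sum_(i < m) a (k + i)%N]
   <= q * \sum_(k < N + n) a k)%N.
Proof.
pose B (a : nat -> bool) k :=
  [exists m : 'I_n.+1, m < q * \sum_(i < m) a (k + i)%N]%N.
have Bshift m (c : nat -> bool) k : B c (m + k)%N = B (fun j => c (m + j)%N) k.
  by apply: eq_existsb => i; under eq_bigr do rewrite -addnA.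
have sum_le K (c : nat -> bool) : (\sum_(k < K) c k <= K)%N.
  by rewrite -[leqRHS]card_ord -sum1_card leq_sum// => i _; case: (c i).
rewrite -[leqLHS]/(\sum_(k < N) B a k)%N.
(* Skipping a time or jumping over a segment replaces [a] by a translate. *)
elim/ltn_ind: N a => N IH a; case: N IH => [|N] IH; first by rewrite big_ord0.
have [/existsP[m]|B0] := boolP (B a 0%N); last first.
  rewrite big_ord_recl (negbTE B0) add0n.
  under eq_bigr do rewrite /= /bump Bshift.
  apply: leq_trans (IH N _ (fun j => a j.+1)) _ => //.
  by rewrite leq_mul2l addSn [in leqRHS]big_ord_recl leq_addl orbT.
have [Nm|mN] := leqP N.+1 m.
  move=> hm; rewrite (leq_trans (sum_le _ _))// (leq_trans Nm)//.
  rewrite (leq_trans (ltnW hm))// leq_mul2l orbC.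
  have le : (m <= N.+1 + n)%N by have := ltn_ord m; lia.
  rewrite (big_ord_widen _ (fun k => nat_of_bool (a k)) le).
  rewrite [leqRHS](bigID (fun i : 'I_ _ => (i < m)%N))/=.
  by rewrite leq_addr.
move=> hm; have m0 : (0 < m)%N.
  by case: (posnP m) hm => [->|//]; rewrite big_ord0 muln0.
rewrite -(subnKC (ltnW mN)) big_split_ord/= -addnA big_split_ord/= mulnDr.
apply: leq_add.
  exact: leq_trans (sum_le _ _) (ltnW hm).
under eq_bigr do rewrite Bshift.
by apply: IH; lia.
Qed.

Section CountingMeasure.
Context d (T : measurableType d) (R : realType) (P : probability T R).

(** The expectation of the pointwise inequality between the counts. *)
Lemma measure_count_le (q N N' : nat) (a b : nat -> T -> bool) :
  (forall k, measurable [set x | a k x]) -> (forall k, measurable [set x | b k x]) ->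
  (forall x, (\sum_(k < N) b k x <= q * \sum_(k < N') a k x)%N) ->
  (\sum_(k < N) P [set x | b k x] <= q%:R%:E * \sum_(k < N') P [set x | a k x])%E.
Proof.
move=> ma mb hab.
have E (K : nat) (c : nat -> T -> bool) (mc : forall k, measurable [set x | c k x]) :
    (\sum_(k < K) P [set x | c k x])%E
    = (\int[P]_x (\sum_(k < K) c k x)%N%:R%:E)%E.
  rewrite (@eq_integral _ _ _ P setT
    (fun x => \sum_(k < K) (\1_[set x | c k x] x)%:E)%E); last first.
    move=> x _; rewrite natr_sum sumEFin; congr EFin.
    by apply: eq_bigr => k _; rewrite indicE mem_setE.
  rewrite ge0_integral_sum//; last first.
    by move=> k; apply/measurable_EFinP; exact: measurable_indic.
  by apply: eq_bigr => k _; rewrite integral_indic// setIT.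
have mf (K : nat) (c : nat -> T -> bool) (mc : forall k, measurable [set x | c k x]) :
    measurable_fun setT (fun x => ((\sum_(k < K) c k x)%N%:R : R)%:E).
  apply/measurable_EFinP.
  under eq_fun do rewrite natr_sum.
  apply: measurable_sum => k.
  rewrite (_ : (fun x => _) = \1_[set x | c k x]); first exact: measurable_indic.
  by apply/funext => x; rewrite indicE mem_setE.
rewrite !E// -ge0_integralZl//=; last exact: mf.
apply: ge0_le_integral => //=; [exact: mf| exact/measurable_funeM/mf|].
by move=> x _; rewrite -EFinM lee_fin -natrM ler_nat.
Qed.
End CountingMeasure.

Section TwistedSum.
Variables (R : realType) (T : Type) (S : T -> T) (phi : T -> R) (w : R[i]).

(** Birkhoff sums of [phi] in a rotating frame: [w ^+ n * twisted_sum n x] solves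
    the recurrence [y_(n + 1) = w * y_n + phi (iter n S x)] from [y_0 = 0]. *)
Definition twisted_sum n x : R[i] :=
  \sum_(j < n) w^-1 ^+ j.+1 * (phi (iter j S x))%:C%C.

(** The cocycle identity: after time [m] the sums go on from where they are, as
    an isometric copy of the sums of [iter m S x]. *)
Lemma twisted_sumD m n x :
  twisted_sum (m + n) x = twisted_sum m x + w^-1 ^+ m * twisted_sum n (iter m S x).
Proof.
rewrite /twisted_sum big_split_ord/=; congr (_ + _); rewrite mulr_sumr.
by apply: eq_bigr => j _; rewrite mulrA -exprD addnS -iterD addnC.
Qed.

End TwistedSum.

Section TwistedCocycle.
Context d (T : measurableType d) (R : realType).
Local Notation C := R[i].
Variables (P : probability T R) (S : T -> T) (phi : T -> R) (w : C).
Hypothesis mS : measurable_fun setT S.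
Hypothesis S_inv : measure_invariant P S.
Hypothesis mphi : measurable_fun setT phi.
Hypothesis w1 : nC w = 1.
Local Notation twisted_sum := (twisted_sum S phi w).

Lemma nC_rot m : nC (w^-1 ^+ m) = 1.
Proof. by rewrite nCX nC_V w1 invr1 expr1n. Qed.

Lemma measurable_iter n : measurable_fun setT (iter n S).
Proof. by elim: n => [|n IH]; [exact: measurable_id|exact: measurableT_comp]. Qed.

Lemma measurable_twisted_sum n : measurable_complex (twisted_sum n).
Proof.
apply: measurable_complex_sum => j; apply: measurable_complexM.
  exact: measurable_complex_cst.
split; last exact: measurable_cst.
exact: (measurableT_comp mphi (measurable_iter j)).
Qed.

Lemma iter_inv n A : measurable A -> P (iter n S @^-1` A) = P A.
Proof.
elim: n A => [//|n IH] A mA.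
by rewrite -[LHS]/(P (iter n S @^-1` (S @^-1` A))) IH ?S_inv// -[_ @^-1` _]setTI;
  exact: mS.
Qed.

Let often_large n M x :=
  [exists m : 'I_n.+1, m < 4 * \sum_(i < m) (M < nC (twisted_sum i x))%R]%N.

Let measurable_often_large n M : measurable [set x | often_large n M x].
Proof.
rewrite (_ : mkset _ = [set x | exists m : 'I_n.+1,
   (m < 4 * \sum_(i < m) (M < nC (twisted_sum i x))%R)%N]).
  apply: measurable_exists => m.
  apply: (@measurable_count _ _ (fun i x => M < nC (twisted_sum i x))%R m
    (fun s => m < 4 * s)%N) => k.
  exact/measurable_lt_nC/measurable_twisted_sum.
by apply/seteqP; split=> x /existsP.
Qed.

(** A bound on the measure of each single event [M < nC (twisted_sum k x)] bounds
    the measure of the union over all [m] of the events that this happens, with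
    a radius twice as large, at more than a quarter of the times before [m].  If
    [iter k S x] lies in the latter union, then either the sum of [x] at time
    [k] is already large, or it is small and the times at which the sums of [x]
    are large have high density right after [k].  Averaging over [k], the second
    case is bounded by the covering argument. *)
Lemma maximal_inequality (M eps : R) :
  (forall k, (P [set x | (M < nC (twisted_sum k x))%R] <= eps%:E)%E) ->
  (P [set x | exists m, (m < 4 * \sum_(i < m)
       (M + M < nC (twisted_sum i x))%R)%N] <= (9 * eps)%:E)%E.
Proof.
move=> tight.
have bound n : (P [set x | often_large n (M + M)%R x] <= (9 * eps)%:E)%E.
  pose a k x := M < nC (twisted_sum k x).
  pose b k x := [exists m : 'I_n.+1, m < 4 * \sum_(i < m) a (k + i)%N x]%N.
  have ma k : measurable [set x | a k x].
    exact/measurable_lt_nC/measurable_twisted_sum.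
  have mb k : measurable [set x | b k x].
    rewrite (_ : mkset _ = [set x | exists m : 'I_n.+1,
       (m < 4 * \sum_(i < m) a (k + i) x)%N]).
      apply: measurable_exists => m.
      exact: (@measurable_count _ _ (fun i x => a (k + i)%N x) m
        (fun s => m < 4 * s)%N).
    by apply/seteqP; split=> x /existsP.
  have step k : (P [set x | often_large n (M + M)%R x] <=
      P [set x | a k x] + P [set x | b k x])%E.
    rewrite -(iter_inv k)//.
    apply: le_trans (measureU2 _ _ _) => //.
    rewrite le_measure// ?inE.
    - by rewrite -[_ @^-1` _]setTI; exact: measurable_iter.
    - exact: measurableU.
    move=> x /= /existsP[m hm]; have [ax|nax] := boolP (a k x); first by left.
    right; apply/existsP; exists m; apply: leq_trans hm _.
    rewrite leq_mul2l /=; apply: leq_sum => i _.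
    case: ltP => // large; rewrite /a ltNge; case: leP => // small.
    move: nax; rewrite /a -leNgt => smallk.
    suff : nC (twisted_sum i (iter k S x)) <= M + M by rewrite leNgt large.
    have -> : nC (twisted_sum i (iter k S x)) =
        nC (twisted_sum (k + i)%N x - twisted_sum k x).
      by rewrite twisted_sumD addrC addKr nCM nC_rot mul1r.
    by rewrite (le_trans (nC_B _ _))// lerD.
  (* Averaging over the first n + 1 times, the covering argument looks n times
     further ahead and costs 4 (2n + 1) / (n + 1) < 8, to which [a] adds 1. *)
  have := @measure_count_le _ _ _ P 4 n.+1 (n.+1 + n) a b ma mb
    (fun x => @count_visits_le 4 n n.+1 (fun k => a k x)).
  set p := P _ in step *; have p_fin : p \is a fin_num by exact: fin_num_measure.
  move=> sum_b.
  have sum_a K : (\sum_(k < K) P [set x | a k x] <= (K%:R * eps)%:E)%E.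
    apply: (@le_trans _ _ (\sum_(k < K) eps%:E)%E).
      by apply: lee_sum => k _; exact: tight.
    by rewrite sumEFin sumr_const card_ord mulr_natl.
  have : (\sum_(k < n.+1) p <=
      \sum_(k < n.+1) P [set x | a k x] + \sum_(k < n.+1) P [set x | b k x])%E.
    by rewrite -big_split/=; apply: lee_sum => k _; exact: step.
  have q0 : (0 <= 4%:R%:E :> \bar R)%E by rewrite lee_fin.
  have sb := le_trans sum_b (lee_wpmul2l q0 (sum_a (n.+1 + n)%N)).
  move=> /le_trans/(_ (leeD (sum_a n.+1) sb)).
  rewrite -[p](fineK p_fin) sumEFin sumr_const card_ord -EFinM -EFinD !lee_fin.
  rewrite natrD => h.
  have n0 : 0 < n.+1%:R :> R by rewrite ltr0n.
  have e0 : 0 <= eps by rewrite -lee_fin (le_trans _ (tight 0%N)).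
  rewrite -(ler_pM2l n0) [leLHS]mulr_natl; apply: le_trans h _.
  have : n%:R <= n.+1%:R :> R by rewrite ler_nat.
  by nra.
rewrite (_ : mkset _ = \bigcup_n [set x | often_large n (M + M)%R x]); last first.
  apply/seteqP; split=> [x [m hm]|x [n _ /existsP[m hm]]]; last by exists m.
  by exists m => //=; apply/existsP; exists ord_max.
have cvgP := @nondecreasing_cvg_mu _ _ _ P
  (fun n => [set x | often_large n (M + M)%R x])
  (fun n => measurable_often_large n _)
  (bigcupT_measurable _ (fun n => measurable_often_large n _)).
rewrite -(cvg_lim _ (cvgP _))//; last first.
  move=> m n mn; apply/subsetPset => x /existsP[k hk]; apply/existsP.
  have km : (k < n.+1)%N by rewrite (leq_trans (ltn_ord k)).
  by exists (Ordinal km).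
apply: lime_le; last by apply: nearW => n; exact: bound.
apply/cvg_ex; eexists; apply: cvgP.
move=> m n mn; apply/subsetPset => x /existsP[k hk]; apply/existsP.
have km : (k < n.+1)%N by rewrite (leq_trans (ltn_ord k)).
by exists (Ordinal km).
Qed.
End TwistedCocycle.

(** * Chebyshev centers in the plane *)

Section ChebyshevCenter.
Variable R : realType.
Local Notation C := R[i].
Implicit Types (U : set C) (c q a : C).

Definition enclosing U c (s : R) := forall a, U a -> nC (a - c) <= s.

(** Saying that [q] does as well as any other center, without mention of the
    radius, makes the notion transport along isometries at once. *)
Definition chebyshev_center U q := forall c s, enclosing U c s -> enclosing U q s.

Definition circumradius U : R := inf [set s | exists c, enclosing U c s].

Definition center U : C := xget 0 (chebyshev_center U).

Definition enclosable U := U !=set0 /\ exists c s, enclosing U c s.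

Lemma nC_sq (z : C) : nC z ^+ 2 = complex.Re z ^+ 2 + complex.Im z ^+ 2.
Proof. by rewrite sqr_sqrtr// addr_ge0// sqr_ge0. Qed.

Lemma nC_le_sum (z : C) : nC z <= `|complex.Re z| + `|complex.Im z|.
Proof.
rewrite -(@ler_pXn2r _ 2)// ?nnegrE ?nC_ge0 ?addr_ge0// nC_sq.
rewrite -(real_normK (num_real (complex.Re z))) -(real_normK (num_real (complex.Im z))).
by rewrite sqrrD lerD2r lerDl mulrn_wge0// mulr_ge0.
Qed.

Lemma enclosing_ge0 U c s : U !=set0 -> enclosing U c s -> 0 <= s.
Proof. by move=> [a Ua] /(_ a Ua); exact: le_trans (nC_ge0 _). Qed.

Lemma circumradius_le U c s : U !=set0 -> enclosing U c s -> circumradius U <= s.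
Proof.
move=> U0 h; apply: ge_inf; last by exists c.
by exists 0 => t [c'] /(enclosing_ge0 U0).
Qed.

Lemma circumradius_ge0 U : enclosable U -> 0 <= circumradius U.
Proof.
move=> [U0 [c [s h]]]; apply: lb_le_inf; first by exists s, c.
by move=> t [c'] /(enclosing_ge0 U0).
Qed.

Lemma enclosing_center U q : enclosable U -> chebyshev_center U q ->
  enclosing U q (circumradius U).
Proof.
move=> [U0 [c [s h]]] hq a Ua; apply: lb_le_inf; first by exists s, c.
by move=> t [c' /hq]; exact.
Qed.

(** The parallelogram identity: a disc around the midpoint of two centers of
    nearly minimal discs would be smaller than the minimal one if the centers
    were far apart. *)
Lemma enclosing_dist U c s c' s' : U !=set0 ->
  enclosing U c s -> enclosing U c' s' ->
  nC (c - c') ^+ 2 <= 2 * s ^+ 2 + 2 * s' ^+ 2 - 4 * circumradius U ^+ 2.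
Proof.
move=> U0 h h'; pose m : C := Complex ((complex.Re c + complex.Re c') / 2)
  ((complex.Im c + complex.Im c') / 2).
pose t := (s ^+ 2 + s' ^+ 2) / 2 - nC (c - c') ^+ 2 / 4.
have near_m a : U a -> nC (a - m) ^+ 2 <= t.
  move=> Ua.
  have : nC (a - c) ^+ 2 <= s ^+ 2.
    by rewrite lerXn2r ?nnegrE ?nC_ge0 ?(enclosing_ge0 U0 h) ?h.
  have : nC (a - c') ^+ 2 <= s' ^+ 2.
    by rewrite lerXn2r ?nnegrE ?nC_ge0 ?(enclosing_ge0 U0 h') ?h'.
  rewrite /t !nC_sq /m.
  case: a {Ua} => a1 a2; case: c {h m t} => c1 c2; case: c' {h'} => d1 d2 /=.
  by lra.
have t0 : 0 <= t by have [a /near_m] := U0; exact: le_trans (sqr_ge0 _).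
have /(circumradius_le U0) : enclosing U m (Num.sqrt t).
  move=> a Ua; rewrite -(@ler_pXn2r _ 2)// ?nnegrE ?nC_ge0 ?sqrtr_ge0//.
  by rewrite (sqr_sqrtr t0) near_m.
have r0 : 0 <= circumradius U by apply: circumradius_ge0; split=> //; exists c, s.
rewrite -(@ler_pXn2r _ 2)// ?nnegrE ?sqrtr_ge0// (sqr_sqrtr t0) /t.
by lra.
Qed.

Lemma center_dist U q c s : enclosable U -> chebyshev_center U q ->
  enclosing U c s -> nC (c - q) ^+ 2 <= 2 * (s ^+ 2 - circumradius U ^+ 2).
Proof.
move=> bU hq h; have [U0 _] := bU.
by have := enclosing_dist U0 h (enclosing_center bU hq); lra.
Qed.

Lemma chebyshev_center_unique U q q' : enclosable U ->
  chebyshev_center U q -> chebyshev_center U q' -> q = q'.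
Proof.
move=> bU hq hq'; have := center_dist bU hq' (enclosing_center bU hq).
rewrite subrr mulr0 => h; apply/eqP; rewrite -subr_eq0; apply/eqP.
have /eqP : nC (q - q') ^+ 2 = 0 by apply/eqP; rewrite eq_le h sqr_ge0.
rewrite nC_sq paddr_eq0 ?sqr_ge0// !sqrf_eq0.
by case: (q - q') => x y /= /andP[/eqP-> /eqP->].
Qed.

Lemma cauchy_bound (x : nat -> R) (K : R) :
  (forall n m, (n <= m)%N -> `|x n - x m| ^+ 2 <= K / n.+1%:R) -> cvgn x.
Proof.
move=> h; apply/cauchy_cvgP/cauchy_exP => e e0.
have [N hN] : exists N : nat, K / e ^+ 2 < N.+1%:R.
  exists (Num.truncn (K / e ^+ 2)); exact: truncnS_gt.
exists (x N); exists N => // m /= /h le_m; rewrite /ball/= -(@ltr_pXn2r _ 2)// ?nnegrE ?(ltW e0)//.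
rewrite (le_lt_trans le_m)// ltr_pdivrMr ?ltr0n// mulrC -ltr_pdivrMr//.
by rewrite exprn_gt0.
Qed.

(** By [enclosing_dist], centers of discs whose radii tend to the circumradius
    form a Cauchy sequence. *)
Lemma chebyshev_center_exists U : enclosable U -> exists q, chebyshev_center U q.
Proof.
move=> bU; have [U0 [c0 [s0 h0]]] := bU; pose r := circumradius U.
have r0 : 0 <= r := circumradius_ge0 bU.
have ex n : exists c, enclosing U c (r + n.+1%:R^-1).
  have n0 : 0 < n.+1%:R^-1 :> R by rewrite invr_gt0 ltr0n.
  have [|t [c hc] tn] := @inf_adherent _ [set s | exists c, enclosing U c s] _ n0.
    split; first by exists s0, c0.
    by exists 0 => t [c'] /(enclosing_ge0 U0).
  by exists c => a /hc /le_trans; apply; exact: ltW.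
have [c hc] := choice ex.
have dist n m : (n <= m)%N -> nC (c n - c m) ^+ 2 <= (8 * r + 4) / n.+1%:R.
  move=> nm; apply: (le_trans (enclosing_dist U0 (hc n) (hc m))).
  have : m.+1%:R^-1 <= n.+1%:R^-1 :> R by rewrite lef_pV2 ?posrE ?ltr0n// ler_nat.
  have : n.+1%:R^-1 <= 1 :> R by rewrite invf_le1 ?ltr0n// ler1n.
  have : 0 < m.+1%:R^-1 :> R by rewrite invr_gt0 ltr0n.
  move: (n.+1%:R^-1) (m.+1%:R^-1) => x y y0 x1 yx; rewrite -/r.
  by nra.
have cRe : cvgn (fun n => complex.Re (c n)).
  apply: (@cauchy_bound _ (8 * r + 4)) => n m nm; apply: le_trans (dist n m nm).
  by rewrite nC_sq !raddfB real_normK ?num_real// lerDl sqr_ge0.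
have cIm : cvgn (fun n => complex.Im (c n)).
  apply: (@cauchy_bound _ (8 * r + 4)) => n m nm; apply: le_trans (dist n m nm).
  by rewrite nC_sq !raddfB real_normK ?num_real// lerDr sqr_ge0.
pose q : C := Complex (limn (fun n => complex.Re (c n))) (limn (fun n => complex.Im (c n))).
exists q => c' s h a Ua; apply: (@le_trans _ _ r); last exact: circumradius_le h.
suff key (e : R) : 0 < e -> nC (a - q) <= r + e by exact/ler_addgt0Pr.
move=> e0; have e3 : 0 < e / 3 by rewrite divr_gt0.
have [n [hn1 hn2 hn3]] : exists n, [/\
   `|limn (fun n => complex.Re (c n)) - complex.Re (c n)| < e / 3,
   `|limn (fun n => complex.Im (c n)) - complex.Im (c n)| < e / 3 & n.+1%:R^-1 < e / 3].
  near \oo => n; exists n; split.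
  - by near: n; move/cvgrPdist_lt : cRe; apply.
  - by near: n; move/cvgrPdist_lt : cIm; apply.
  - by near: n; exact: near_infty_natSinv_lt (PosNum e3).
have near_q : nC (c n - q) < e / 3 + e / 3.
  by rewrite (le_lt_trans (nC_le_sum _))// !raddfB/= ltrD// distrC.
have near_c := hc n a Ua.
rewrite -[a - q](subrKA (c n)) (le_trans (nC_D _ _))//.
move: near_q near_c hn3; rewrite -/r; move: (nC _) (nC _) n.+1%:R^-1.
by move=> x y z; lra.
Unshelve. all: by end_near.
Qed.

Lemma center_chebyshev U : enclosable U -> chebyshev_center U (center U).
Proof. by move=> /chebyshev_center_exists[q hq]; exact: (xgetPex 0 (ex_intro _ q hq)). Qed.

Lemma center_isometry U U' (w e : C) : nC w = 1 -> enclosable U ->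
  (forall a, U' (w * (a - e)) <-> U a) -> center U' = w * (center U - e).
Proof.
move=> w1 bU UU'.
have w0 : w != 0 by apply: contra_eq_neq w1 => ->; rewrite nC_0 eq_sym oner_eq0.
pose g a := w * (a - e); pose gi a := w^-1 * a + e.
have gK a : gi (g a) = a by rewrite /gi /g mulKf// subrK.
have giK a : g (gi a) = a by rewrite /gi /g addrK mulVKf.
have giso a b : nC (g a - g b) = nC (a - b).
  by rewrite /g -mulrBr nCM w1 mul1r opprB addrA subrK.
have enc c s : enclosing U' (g c) s <-> enclosing U c s.
  split=> h a; first by move=> /UU'/h; rewrite giso.
  by rewrite -(giK a) => /UU'/h; rewrite giso.
have U'b : enclosable U'.
  have [[a Ua] [c [s h]]] := bU; split; first by exists (g a); exact/UU'.
  by exists (g c), s; exact/enc.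
apply: (chebyshev_center_unique U'b (center_chebyshev U'b)).
move=> c s; rewrite -(giK c) => /enc h.
by apply/enc; exact: (center_chebyshev bU) h.
Qed.
End ChebyshevCenter.

Section MeasurableCenter.
Context d (T : measurableType d) (R : realType).
Local Notation C := R[i].

Definition ratC (p : rat * rat) : C := Complex (ratr p.1) (ratr p.2).

Lemma ratC_dense (c : C) (e : R) : 0 < e -> exists p, nC (c - ratC p) < e.
Proof.
move=> e0; case: c => x y.
have near_rat (z : R) : exists r : rat, `|z - ratr r| < e / 2.
  have [|r] := @rat_in_itvoo R (z - e / 2) (z + e / 2).
    by rewrite ltrD2l gtrN// divr_gt0.
  rewrite in_itv/= => /andP[zr rz]; exists r.
  by rewrite ltr_norml; apply/andP; split; lra.
have [[p hp] [q hq]] := (near_rat x, near_rat y).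
exists (p, q); rewrite (le_lt_trans (nC_le_sum _))//=.
by rewrite [ltRHS](splitr e) ltrD.
Qed.

Variable U : T -> set C.
Hypothesis U_open : forall x a, U x a ->
  exists2 e : R, 0 < e & forall a', nC (a' - a) < e -> U x a'.
Hypothesis mU : forall c, measurable [set x | U x c].

(** As the sets are open, a disc encloses one of them as soon as it does so for
    its points with rational coordinates, which makes countably many conditions. *)
Lemma measurable_enclosing c (s : R) : measurable [set x | enclosing (U x) c s].
Proof.
rewrite (_ : mkset _ = [set x | forall p,
    U x (ratC p) -> nC (ratC p - c) <= s]).
  apply: measurable_forall => p; apply: measurable_imply; first exact: mU.
  exact: measurable_constant.
apply/seteqP; split=> x /= h => [p /h//|a Ua].
rewrite leNgt; apply/negP => large.
have [e e0 he] := U_open Ua.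
have [|p] := @ratC_dense a (Num.min e (nC (a - c) - s)).
  by rewrite lt_min e0 subr_gt0.
rewrite lt_min => /andP[pe ps].
have := h p; rewrite nC_distC in pe; move=> /(_ (he _ pe)) small.
have := nC_D (a - ratC p) (ratC p - c); rewrite subrKA.
by lra.
Qed.

Lemma measurable_enclosable : measurable [set x | enclosable (U x)].
Proof.
rewrite (_ : mkset _ = [set x | exists p, U x (ratC p)] `&`
                       [set x | exists n : nat, enclosing (U x) 0 n%:R]).
  apply: measurableI; apply: measurable_exists => n; first exact: mU.
  exact: measurable_enclosing.
apply/seteqP; split=> x /= [].
  move=> [a Ua] [c [s h]]; split.
    have [e e0 he] := U_open Ua; have [p hp] := ratC_dense a e0.
    by exists p; apply: he; rewrite nC_distC.
  exists (Num.truncn (s + nC c)).+1 => b Ub; rewrite subr0.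
  apply: le_trans (ltW (truncnS_gt _)).
  by rewrite -[b](subrK c) (le_trans (nC_D _ _))// lerD2r h.
by move=> [p Up] [n hn]; split; [exists (ratC p)|exists 0, n%:R].
Qed.

(** The center [q] satisfies [l q < t] if and only if [l] is at most some rational
    [t' < t] at all rational points around which some disc of a suitable radius
    [s], larger than the circumradius, encloses the set: such points are dense
    near [q], and all of them are close to [q] when [s] is close to the
    circumradius.  The disc of radius [s0 < s] around [c] forces [s] to be
    strictly larger than the circumradius. *)
Lemma measurable_center_lipschitz (l : C -> R) :
  (forall a b, `|l a - l b| <= nC (a - b)) ->
  measurable_fun setT (fun x => l (center (U x))).
Proof.
move=> lip; apply: (measurability _ (RGenInftyO.measurableE R)) => //.
move=> _ [_ [t ->] <-]; rewrite setTI preimage_itvNyo.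
pose G := [set x | enclosable (U x)].
have mG : measurable G := measurable_enclosable.
(* Off [G] every point is a center, hence the value there is a constant. *)
have offG x : ~ G x -> center (U x) = center [set: C].
  move=> nG; congr xget; apply/funext => q; apply/propext.
  have all_centers (V : set C) : ~ enclosable V -> chebyshev_center V q.
    move=> nV c s h a Va; exfalso; apply: nV.
    by split; [exists a|exists c, s].
  split=> _; apply: all_centers => // -[_ [c [s h]]].
  have := h (c + (`|s| + 1)%:C%C) I; rewrite addrC addKr.
  have := Re_nC (`|s| + 1)%:C%C; rewrite /= ger0_norm ?addr_ge0//.
  by have := ler_norm s; lra.
rewrite (_ : mkset _ = (~` G `&` [set x | l (center [set: C]) < t]) `|`
  (G `&` [set x | exists i : (rat * rat) * rat * rat * rat,
    ([set _ | i.1.1.2 < i.1.2 /\ ratr i.2 < t :> R] `&`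
     [set x | enclosing (U x) (ratC i.1.1.1) (ratr i.1.1.2)] `&`
     [set x | forall p, enclosing (U x) (ratC p) (ratr i.1.2) ->
                        l (ratC p) <= ratr i.2]) x])).
  apply: measurableU; apply: measurableI; [exact: measurableC| |exact: mG|].
    exact: measurable_constant.
  apply: measurable_exists => -[[[c s0] s] t'] /=.
  apply: measurableI; first apply: measurableI.
  - exact: measurable_constant.
  - exact: measurable_enclosing.
  apply: measurable_forall => p; apply: measurable_imply.
    exact: measurable_enclosing.
  exact: measurable_constant.
apply/seteqP; split=> x /=.
  have [Gx|nGx] := pselect (G x); last by move=> h; left; rewrite -(offG x).
  move=> lt_t; right; split=> //.
  have [U0 _] := Gx; have hq := center_chebyshev Gx.
  set q := center (U x) in lt_t hq *; set r := circumradius (U x).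
  have r0 : 0 <= r := circumradius_ge0 Gx.
  have [t'] := rat_in_itvoo lt_t; rewrite in_itv/= => /andP[qt' t't].
  set e := ratr t' - l q; have e0 : 0 < e by rewrite subr_gt0.
  (* [r < s < r + D] gives [2 * (s ^+ 2 - r ^+ 2) <= e ^+ 2] in [center_dist]. *)
  pose D := Num.min 1 (e ^+ 2 / (4 * r + 2)).
  have r2 : 0 < 4 * r + 2 by lra.
  have D0 : 0 < D by rewrite lt_min ltr01 divr_gt0 ?exprn_gt0.
  have [|s] := @rat_in_itvoo R r (r + D); first by rewrite ltrDl.
  rewrite in_itv/= => /andP[rs sD].
  have [s0] := rat_in_itvoo rs; rewrite in_itv/= => /andP[rs0 s0s].
  have [|c qc] := @ratC_dense q (ratr s0 - r); first by rewrite subr_gt0.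
  exists (c, s0, s, t'); split; [split|]; rewrite /=.
  - by split=> //; rewrite -(ltr_rat R).
  - move=> a Ua; have := enclosing_center Gx hq Ua; rewrite -/r.
    by have := nC_D (a - q) (q - ratC c); rewrite subrKA; lra.
  move=> p hp; have := center_dist Gx hq hp; rewrite -/r => near_p.
  have : nC (ratC p - q) <= e.
    rewrite -(@ler_pXn2r _ 2)// ?nnegrE ?nC_ge0 ?(ltW e0)//.
    apply: (le_trans near_p).
    have : ratr s - r < 1 by rewrite ltrBlDl (lt_le_trans sD)// lerD2l ge_min lexx.
    have : ratr s - r < e ^+ 2 / (4 * r + 2).
      by rewrite ltrBlDl (lt_le_trans sD)// lerD2l ge_min lexx orbT.
    rewrite ltr_pdivlMr//.
    by move: (e ^+ 2) => ee; nra.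
  have := lip (ratC p) q; rewrite ler_norml => /andP[_].
  by rewrite /e; lra.
move=> [[nGx]|[Gx [[[[c s0] s] t'] /= [[[s0s t't] h0] hs]]]]; first by rewrite (offG x).
have [U0 _] := Gx; have hq := center_chebyshev Gx.
set q := center (U x) in hq *; apply: le_lt_trans t't.
rewrite leNgt; apply/negP => t'q.
have [|p] := @ratC_dense q (Num.min (ratr s - ratr s0) (l q - ratr t')).
  by rewrite lt_min !subr_gt0 ltr_rat s0s.
rewrite lt_min => /andP[ps pt].
have /hs : enclosing (U x) (ratC p) (ratr s).
  move=> a Ua; have := hq _ _ h0 _ Ua; have := nC_D (a - q) (q - ratC p).
  by rewrite subrKA; lra.
by have := lip q (ratC p); rewrite ler_norml => /andP[]; lra.
Qed.
End MeasurableCenter.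

(** * Tight twisted sums are coboundaries *)

Section RareTimes.
Implicit Types a b : nat -> bool.

(** An upper density of at most 1/4, with a bounded error instead of a limit: this
    is both invariant under a shift of time and a countable combination of
    conditions on finitely many times. *)
Definition rare a := exists j, forall N, (4 * \sum_(k < N) a k <= N + j)%N.

Lemma rare_sub a b : (forall k, b k -> a k) -> rare a -> rare b.
Proof.
move=> ba [j hj]; exists j => N; apply: leq_trans (hj N); rewrite leq_mul2l /=.
by apply: leq_sum => k _; have := ba k; case: (b k) => // ->.
Qed.

(** Two rare sets of times cover at most about half of the times. *)
Lemma rare_avoid2 a b : rare a -> rare b -> exists k, ~~ a k /\ ~~ b k.
Proof.
move=> [j hj] [j' hj']; apply: contrapT => none.
pose N := (j + j').+1; have := hj N; have := hj' N.
have : (N <= \sum_(k < N) a k + \sum_(k < N) b k)%N.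
  rewrite -big_split -[leqLHS]card_ord -sum1_card; apply: leq_sum => k _.
  case ak : (a k) => //; case bk : (b k) => //.
  by case: none; exists k; rewrite ak bk.
rewrite /N; move: (\sum_(k < _) a k)%N (\sum_(k < _) b k)%N => s s'.
by lia.
Qed.

Lemma rare_shift a : rare (fun k => a k.+1) <-> rare a.
Proof.
have E N : (\sum_(k < N.+1) a k = a 0 + \sum_(k < N) a k.+1)%N by rewrite big_ord_recl.
split=> -[j hj].
  exists (j + 4)%N => -[|N]; first by rewrite big_ord0 muln0.
  by rewrite E; have := hj N; case: (a 0%N) => /=; lia.
exists j.+1 => N; apply: leq_trans (_ : N.+1 + j <= _)%N; last by lia.
by apply: leq_trans (hj N.+1); rewrite E leq_mul2l leq_addl orbT.
Qed.
End RareTimes.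

Section TwistedCoboundary.
Context d (T : measurableType d) (R : realType).
Local Notation C := R[i].
Variables (P : probability T R) (S : T -> T) (phi : T -> R) (w : C).
Hypothesis mS : measurable_fun setT S.
Hypothesis S_inv : measure_invariant P S.
Hypothesis mphi : measurable_fun setT phi.
Hypothesis w1 : nC w = 1.
Hypothesis tight : forall eps : R, 0 < eps -> exists M : R, forall n,
  (P [set x | (M < nC (twisted_sum S phi w n x))%R] <= eps%:E)%E.
Local Notation sums := (twisted_sum S phi w).

(** By the maximal inequality the exceptional set has measure at most [9 * e] for
    every [e]. *)
Lemma sums_mostly_bounded : {ae P, forall x, exists M : nat, forall m,
  (4 * \sum_(i < m) (M%:R < nC (sums i x))%R <= m)%N}.
Proof.
pose B := [set x | forall M : nat, exists m : nat,
  (m < 4 * \sum_(i < m) (M%:R < nC (sums i x))%R)%N].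
have mB : measurable B.
  apply: measurable_forall => M; apply: measurable_exists => m.
  apply: (@measurable_count _ _ (fun i x => M%:R < nC (sums i x))%R m
    (fun s => m < 4 * s)%N) => k.
  by apply: measurable_lt_nC; exact: measurable_twisted_sum.
exists B; split=> //; last first.
  move=> x /= nh M; apply: contrapT => nm; apply: nh; exists M => m.
  by rewrite leqNgt; apply/negP => h; apply: nm; exists m.
apply/eqP; rewrite eq_le measure_ge0 andbT.
suff le_eps (e : R) : 0 < e -> (P B <= e%:E)%E.
  apply/lee_addgt0Pr => e e0; rewrite add0e; exact: le_eps.
move=> e0; have e9 : 0 < e / 9 by rewrite divr_gt0.
have [M hM] := tight e9.
have := maximal_inequality mS S_inv mphi w1 hM.
rewrite mulrC divfK ?pnatr_eq0//; apply: le_trans.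
apply: le_measure; rewrite ?inE//.
  apply: measurable_exists => m.
  apply: (@measurable_count _ _ (fun i x => M + M < nC (sums i x))%R m
    (fun s => m < 4 * s)%N) => k.
  by apply: measurable_lt_nC; exact: measurable_twisted_sum.
move=> x /(_ (Num.truncn (M + M)).+1)[m hm]; exists m.
apply: leq_trans hm _; rewrite leq_mul2l /=; apply: leq_sum => i _.
case: ltP => // h; rewrite (_ : (_ < _)%R)//.
exact: lt_trans (truncnS_gt _) h.
Qed.

(** The points that the sums approach closer than [M] for most times; the margin
    [l.+1%:R^-1] makes this set open. *)
Definition region (M : nat) x : set C :=
  [set c | exists l : nat,
     rare (fun k => M%:R - l.+1%:R^-1 < nC (sums k x - c))].

Lemma region_open M x a : region M x a ->
  exists2 e : R, 0 < e & forall a', nC (a' - a) < e -> region M x a'.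
Proof.
move=> [l hl]; exists (l.+1%:R^-1 - l.+2%:R^-1).
  by rewrite subr_gt0 ltf_pV2 ?posrE ?ltr0n// ltr_nat.
move=> a' aa'; exists l.+1; apply: rare_sub hl => k h.
rewrite nC_distC in aa'; have := nC_D (sums k x - a) (a - a'); rewrite subrKA.
move: h aa'; move: (nC _) (nC _) (nC _) M%:R l.+1%:R^-1 l.+2%:R^-1.
by move=> *; lra.
Qed.

Lemma region_diam M x a a' : region M x a -> region M x a' ->
  nC (a' - a) <= M%:R + M%:R.
Proof.
move=> [l hl] [l' hl']; have [k []] := rare_avoid2 hl hl'.
rewrite -!leNgt => h h'; have := nC_B (sums k x - a) (sums k x - a').
rewrite opprB [_ - a + _]addrC subrKA.
have : 0 < l.+1%:R^-1 :> R by rewrite invr_gt0 ltr0n.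
have : 0 < l'.+1%:R^-1 :> R by rewrite invr_gt0 ltr0n.
move: h h'; move: (nC _) (nC _) (nC _) M%:R l.+1%:R^-1 l'.+1%:R^-1.
by move=> *; lra.
Qed.

Lemma twisted_sum1 x : sums 1 x = w^-1 * (phi x)%:C%C.
Proof. by rewrite /twisted_sum big_ord1. Qed.

(** The isometry carries the sums of [x] at time [k + 1] to the sums of [S x] at
    time [k], and rare sets of times are shift-invariant. *)
Lemma region_equivariant M x c :
  region M (S x) (w * (c - sums 1 x)) <-> region M x c.
Proof.
have w0 : w != 0 by apply: contra_eq_neq w1 => ->; rewrite nC_0 eq_sym oner_eq0.
have E k : nC (sums k (S x) - w * (c - sums 1 x)) = nC (sums k.+1 x - c).
  rewrite -[k.+1]add1n twisted_sumD /= expr1.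
  rewrite (_ : sums k (S x) - _ = w * (w^-1 * sums k (S x) - (c - sums 1 x))).
    by rewrite nCM w1 mul1r; congr nC; ring.
  by rewrite [RHS]mulrBr mulVKf.
have shift l := rare_shift (fun k => M%:R - l.+1%:R^-1 < nC (sums k x - c)).
split=> -[l hl]; exists l.
  by apply/shift; apply: rare_sub hl => k; rewrite E.
by move/shift: hl; apply: rare_sub => k; rewrite E.
Qed.

Lemma measurable_region M c : measurable [set x | region M x c].
Proof.
apply: measurable_exists => l; apply: measurable_exists => j.
apply: measurable_forall => N.
apply: (@measurable_count _ _ (fun k x => M%:R - l.+1%:R^-1 < nC (sums k x - c)) N
    (fun s => 4 * s <= N + j)%N) => k.
apply: measurable_lt_nC; apply: measurable_complexD.
  exact: measurable_twisted_sum.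
exact: measurable_complex_cst.
Qed.

(** Each region is bounded, but it may be empty if [M] is too small; the least [M]
    for which it is not is a choice that is invariant under [S]. *)
Definition least_region x : set C := [set c | exists M, region M x c /\
  forall M', (M' < M)%N -> ~ exists c', region M' x c'].

Lemma least_region_open x a : least_region x a ->
  exists2 e : R, 0 < e & forall a', nC (a' - a) < e -> least_region x a'.
Proof.
move=> [M [/region_open[e e0 he] least]]; exists e => // a' /he.
by exists M.
Qed.

Lemma measurable_least_region c : measurable [set x | least_region x c].
Proof.
apply: measurable_exists => M; apply: measurableI; first exact: measurable_region.
apply: measurable_forall => M'; apply: measurable_imply.
  exact: measurable_constant.
apply: measurableC; rewrite [X in measurable X](_ : _ = [set x | exists p, region M' x (ratC R p)]).
  by apply: measurable_exists => p; exact: measurable_region.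
apply/seteqP; split=> x /= [c' hc']; last by exists (ratC R c').
have [e e0 he] := region_open hc'; have [p hp] := ratC_dense c' e0.
by exists p; apply: he; rewrite nC_distC.
Qed.

Lemma least_region_equivariant x c :
  least_region (S x) (w * (c - sums 1 x)) <-> least_region x c.
Proof.
have w0 : w != 0 by apply: contra_eq_neq w1 => ->; rewrite nC_0 eq_sym oner_eq0.
split=> -[M [rM least]]; exists M.
  split; first exact: (region_equivariant M x c).1.
  move=> M' /least nM' [c' hc']; apply: nM'.
  by exists (w * (c' - sums 1 x)); exact: (region_equivariant M' x c').2.
split; first exact: (region_equivariant M x c).2.
move=> M' /least nM' [c' hc']; apply: nM'; exists (w^-1 * c' + sums 1 x).
by apply: (region_equivariant M' x _).1; rewrite addrK mulVKf.
Qed.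

Lemma least_region_enclosable x M :
  (forall m, (4 * \sum_(i < m) (M%:R < nC (sums i x))%R <= m)%N) ->
  enclosable (least_region x).
Proof.
move=> hM; have ex : exists M, `[< exists c, region M x c >].
  exists M.+1; apply/asboolP; exists 0, 0%N, 0%N => N; rewrite addn0.
  by under eq_bigr do rewrite invr1 -natr1 addrK subr0.
case: (ex_minnP ex) => K /asboolP[c rc] least.
have least_c : least_region x c.
  exists K; split=> // K' ltK h; have := least K' (asboolT h).
  by rewrite leqNgt ltK.
split; first by exists c.
exists c, (K%:R + K%:R) => a [K' [rK' least']].
have [ltKK'|] := ltnP K K'; first by case: (least' _ ltKK'); exists c.
have /least KK' : `[< exists c, region K' x c >] by apply/asboolP; exists a.
move=> leK; have KE : K' = K by lia.
by rewrite KE in rK'; exact: region_diam rc rK'.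
Qed.

(** The Chebyshev center [q x] of [least_region x] moves by the isometry that
    carries the sums of [x] to those of [S x], which reads
    [q (S x) = w * q x - phi x]. *)
Theorem tight_twisted_coboundary : exists beta : T -> C,
  measurable_complex beta /\
  {ae P, forall x, (phi x)%:C%C = beta (S x) - w * beta x}.
Proof.
exists (fun x => -1 * center (least_region x)); split.
  apply: measurable_complexM; first exact: measurable_complex_cst.
  split.
    apply: (@measurable_center_lipschitz _ _ _ _ least_region_open
      measurable_least_region (@complex.Re R)) => a b.
    by rewrite -raddfB Re_nC.
  apply: (@measurable_center_lipschitz _ _ _ _ least_region_open
    measurable_least_region (@complex.Im R)) => a b.
  rewrite -raddfB -(@ler_pXn2r _ 2)// ?nnegrE ?nC_ge0//.
  by rewrite nC_sq real_normK ?num_real// lerDr sqr_ge0.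
apply: filterS sums_mostly_bounded => x [M hM].
have bU := least_region_enclosable hM.
rewrite (center_isometry w1 bU (least_region_equivariant x)) twisted_sum1.
have w0 : w != 0 by apply: contra_eq_neq w1 => ->; rewrite nC_0 eq_sym oner_eq0.
by field.
Qed.
End TwistedCoboundary.

(** * Borel sets of spaces with countably many coordinates *)

Section CoordinateTopology.
Context (R : realType) (X : topologicalType) (J : countType) (c : J -> X -> R).

(** Only one half of saying that the topology is the initial one for the
    coordinates, the one that makes open sets countable unions of cylinders. *)
Definition coordinate_topology := forall (O : set X) p, open O -> O p ->
  exists (s : seq J) (e : R), 0 < e /\
    forall q, (forall i, i \in s -> `|c i q - c i p| < e) -> O q.

Hypothesis top : coordinate_topology.

(** An open set is the union of the cylinders with rational data that it
    contains. *)
Lemma measurable_preimage_coordinates d (T : measurableType d) (g : T -> X) (B : set X) :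
  (forall i, measurable_fun setT (fun x => c i (g x))) -> open B ->
  measurable (g @^-1` B).
Proof.
move=> mg oB.
pose cyl (k : seq (J * rat) * rat) : set X :=
  [set q | forall ir, ir \in k.1 -> `|c ir.1 q - ratr ir.2| < ratr k.2].
rewrite (_ : _ @^-1` _ = [set x | exists k,
    ([set _ | cyl k `<=` B] `&` [set x | cyl k (g x)]) x]).
  apply: measurable_exists => -[s e]; apply: measurableI.
    exact: measurable_constant.
  apply: measurable_forall => ir; apply: measurable_imply.
    exact: measurable_constant.
  have := measurable_fun_ltr (measurableT_comp (@normr_measurable R setT)
    (measurable_funB (mg ir.1) (@measurable_cst _ _ T R setT (ratr ir.2))))
    (@measurable_cst _ _ T R setT (ratr e)).
  by move=> /(_ measurableT [set true] I); rewrite setTI.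
apply/seteqP; split=> x /=; last by move=> [k [kO hx]]; exact: kO.
move=> Ogx; have [s [e [e0 he]]] := top oB Ogx.
have [|e' ] := @rat_in_itvoo R 0 (e / 2); first by rewrite divr_gt0.
rewrite in_itv/= => /andP[e'0 e'e].
have near_rat i : exists r : rat, `|c i (g x) - ratr r| < ratr e'.
  have [|r] := @rat_in_itvoo R (c i (g x) - ratr e') (c i (g x) + ratr e').
    by rewrite ltrD2l gtrN.
  rewrite in_itv/= => /andP[h1 h2]; exists r.
  by rewrite ltr_norml; apply/andP; split; lra.
have [r hr] := choice near_rat.
exists ([seq (i, r i) | i <- s], e'); split; last first.
  by move=> _ /mapP[j _ ->] /=.
move=> q hq; apply: he => j sj.
have hqj : `|c j q - ratr (r j)| < ratr e' by apply: (hq (j, r j)); rewrite map_f.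
rewrite -(subrKA (ratr (r j))) (le_lt_trans (ler_normD _ _))//.
by have := hr j; rewrite distrC; lra.
Qed.
End CoordinateTopology.

Section CoordinateTopologies.
Variable R : realType.

Lemma coordinate_topology_ptws (J : countType) :
  coordinate_topology (fun (j : J) (y : {ptws J -> R}) => y j).
Proof.
move=> B p oB Bp.
pose near_p (s : seq J) (e : R) :=
  [set q : {ptws J -> R} | forall j, j \in s -> `|q j - p j| < e].
pose F : set_system {ptws J -> R} :=
  [set A | exists s e, 0 < e /\ near_p s e `<=` A].
have FF : Filter F.
  split.
  - by exists [::], 1.
  - move=> A A' [s [e [e0 sA]]] [s' [e' [e'0 sA']]].
    exists (s ++ s'), (Num.min e e'); split; first by rewrite lt_min e0.
    move=> q hq; split; [apply: sA => j js|apply: sA' => j js].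
      by have := hq j; rewrite mem_cat js lt_min => /(_ isT)/andP[].
    by have := hq j; rewrite mem_cat js orbT lt_min => /(_ isT)/andP[].
  - move=> A A' AA' [s [e [e0 sA]]]; exists s, e; split=> //.
    exact: subset_trans AA'.
have : F --> p.
  apply/cvg_sup => j A; rewrite nbhsE => -[_ [[W oW <-] Wp] WA].
  have /nbhs_ballP[e e0 eW] : nbhs (p j) W by exact: open_nbhs_nbhs.
  exists [:: j], e; split=> // q /(_ j); rewrite mem_head => /(_ isT) qp.
  by apply/WA/eW; rewrite /ball/= distrC.
by move=> /(_ B); apply; exact: open_nbhs_nbhs.
Qed.

Lemma coordinate_topology_initial (J : countType) (S : choiceType)
    (X : topologicalType) (f : S -> X) (c : J -> X -> R) :
  coordinate_topology c ->
  coordinate_topology (X := initial_topology f) (fun j x => c j (f x)).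
Proof.
move=> top _ p [B oB <-] Bfp; have [s [e [e0 h]]] := top _ _ oB Bfp.
by exists s, e; split=> // q hq; exact: h.
Qed.

Lemma coordinate_topology_prod (J J' : countType) (X X' : topologicalType)
    (c : J -> X -> R) (c' : J' -> X' -> R) :
  coordinate_topology c -> coordinate_topology c' ->
  coordinate_topology (fun (k : J + J') (x : X * X') =>
    match k with inl j => c j x.1 | inr j => c' j x.2 end).
Proof.
move=> top top' B p oB Bp.
have /open_nbhs_nbhs [[A A'] /= [nA nA'] AB] : open_nbhs p B by split.
have [D [[oD Dp] DA]] : exists D, open_nbhs p.1 D /\ D `<=` A.
  by move: nA; rewrite nbhsE => -[D ? ?]; exists D.
have [D' [[oD' Dp'] DA']] : exists D, open_nbhs p.2 D /\ D `<=` A'.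
  by move: nA'; rewrite nbhsE => -[D' ? ?]; exists D'.
have [s [e [e0 h]]] := top _ _ oD Dp.
have [s' [e' [e'0 h']]] := top' _ _ oD' Dp'.
exists (map inl s ++ map inr s'), (Num.min e e').
split=> [|q hq]; first by rewrite lt_min e0.
apply: AB; split=> /=; [apply/DA/h => j js|apply/DA'/h' => j js].
  have := hq (inl j); rewrite mem_cat map_f// lt_min => /(_ isT).
  by case/andP.
have := hq (inr j); rewrite mem_cat [in X in _ || X]map_f// orbT lt_min => /(_ isT).
by case/andP.
Qed.

Lemma measurable_generated (X : pointedType) (G : set (set X)) d
    (T : measurableType d) (g : T -> X) :
  (forall B, G B -> measurable (g @^-1` B)) ->
  measurable_fun setT (g : T -> g_sigma_algebraType G).
Proof.
move=> mg.
apply: (@measurability _ _ _ (g_sigma_algebraType G) setT g G erefl) => _ [B GB <-].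
by rewrite setTI; exact: mg.
Qed.

Lemma measurable_generated_real (X : pointedType) (G : set (set X)) (f : X -> R) :
  (forall B, open B -> G (f @^-1` B)) ->
  measurable_fun setT (f : g_sigma_algebraType G -> R).
Proof.
move=> Gf; apply: (@measurability _ _ (g_sigma_algebraType G) _ setT f _
  (RGenInftyO.measurableE R)) => _ [_ [t ->] <-].
by rewrite setTI; apply: sub_sigma_algebra; apply: Gf; exact: lray_open.
Qed.
End CoordinateTopologies.

Lemma hausdorff_separated (R : realType) (X : topologicalType) :
  (forall p q : X, p != q -> exists2 c : X -> R, continuous c & c p != c q) ->
  hausdorff_space X.
Proof.
move=> sep p q pq; apply/eqP/contraT => /sep[c cc /eqP cpq]; case: cpq.
apply: Rhausdorff => A B nA nB; have [x [Ax Bx]] := pq _ _ (cc p _ nA) (cc q _ nB).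
by exists (c x).
Qed.

Lemma pushforward_probability d d' (T : measurableType d) (T' : measurableType d')
    (R : realType) (P : probability T R) (g : T -> T') :
  measurable_fun setT g ->
  exists mu : probability T' R, forall A, mu A = P (g @^-1` A).
Proof.
move=> mg; pose g_mfun : {mfun T >-> T'} := HB.pack g (isMeasurableFun.Build _ _ _ _ g mg).
by exists (distribution P g_mfun).
Qed.

Section Spaces.
Variables (R : realType) (f : {poly int}) (f0 : f`_0 != 0).
Local Notation C := R[i].
Local Notation V := (linfZ R).
Local Notation W := (W0 R f).

Lemma linfZ_coordinates :
  coordinate_topology (fun (n : int) (v : V) => linfZ_val v n).
Proof.
exact: (@coordinate_topology_initial R int V _ (@linfZ_val R) _ (@coordinate_topology_ptws R int)).
Qed.

Lemma W0_coordinates : coordinate_topology (fun (n : int) (w : W) => W0_val w n).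
Proof.
exact: (@coordinate_topology_initial R int W _ (@W0_val R f) _ (@coordinate_topology_ptws R int)).
Qed.

Lemma ptws_coord_continuous (Y : topologicalType) (n : int) :
  continuous (fun y : {ptws int -> Y} => y n).
Proof. exact: proj_continuous. Qed.

Lemma linfZ_coord_continuous (n : int) : continuous (fun v : V => linfZ_val v n).
Proof.
move=> v; apply: (@continuous_comp _ _ _ (@linfZ_val R) (fun y : {ptws int -> R} => y n)).
  exact: initial_continuous.
exact: ptws_coord_continuous.
Qed.

Lemma W0_coord_continuous (n : int) : continuous (fun w : W => W0_val w n).
Proof.
move=> w; apply: (@continuous_comp _ _ _ (@W0_val R f) (fun y : {ptws int -> R} => y n)).
  exact: initial_continuous.
exact: ptws_coord_continuous.
Qed.

Lemma W0_hausdorff : hausdorff_space W.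
Proof.
apply: (@hausdorff_separated R) => p q pq.
have [n npq] : exists n, W0_val p n != W0_val q n.
  apply: contrapT => same; move/eqP: pq; apply; apply/val_inj/funext => n.
  by apply/eqP/negPn/negP => npq; apply: same; exists n.
by exists (fun w => W0_val w n) => //; exact: W0_coord_continuous.
Qed.

Definition W0_ball (M : R) : set W := [set w | forall n, `|W0_val w n| <= M].

Lemma f_sigma_continuous n : continuous (fun y : {ptws int -> R} => f_sigma f y n).
Proof.
apply: continuous_big => [|j _ y]; first exact: add_continuous.
rewrite (_ : (fun _ => _) = (fun y : {ptws int -> R} => y (n + j%:Z) * (f`_j)%:~R)).
  exact: cvgMr_tmp (@ptws_coord_continuous R (n + j%:Z) y).
by apply/funext => u; rewrite mulrzr.
Qed.

(** By Tychonoff, the ball being a closed subset of a product of intervals; a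
    cluster point of sequences in the ball solves the recurrence again, so it is
    an element of [W0]. *)
Lemma compact_W0_ball M : compact (W0_ball M).
Proof.
pose K := [set y : {ptws int -> R} | forall n, `[- M, M]%classic (y n)].
have cK : compact K.
  apply: (@tychonoff int (fun=> R) (fun=> `[- M, M]%classic)) => n.
  exact: segment_compact.
pose Z := [set y : {ptws int -> R} | f_sigma f y = 0].
have clZ : closed Z.
  rewrite (_ : Z = \bigcap_(n in setT) (fun y => f_sigma f y n) @^-1` [set 0]).
    apply: closed_bigI => n _; apply: preimage_closed; last exact: closed_eq.
    by move=> y _; exact: f_sigma_continuous.
  apply/seteqP; split=> [y fy n _|y fy]; first by rewrite /preimage /= fy.
  by apply/funext => n; exact: fy.
have cKZ : compact (K `&` Z) := compact_closedI cK clZ.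
move=> F FF FB; pose G := (@W0_val R f) @ F.
have GKZ : G (K `&` Z).
  suff : F (@W0_val R f @^-1` (K `&` Z)) by [].
  apply: filterS FB => w hw; split; last by have /asboolP[] := W0P w.
  by move=> n /=; rewrite in_itv/= -ler_norml.
have [y [[Ky Zy] cly]] := cKZ _ (fmap_proper_filter _ FF) GKZ.
have yW : y \in @W0_pred R f.
  apply/asboolP; split=> //; exists M => n.
  by have := Ky n; rewrite /= in_itv/= -ler_norml.
exists (MkW0 yW); split.
  by move=> n; have := Ky n; rewrite /= in_itv/= -ler_norml.
move=> A B FA [_ [[B' oB' <-] B'y] BB].
have GA : G (@W0_val R f @` A).
  suff : F (@W0_val R f @^-1` (@W0_val R f @` A)) by [].
  by apply: filterS FA => w Aw; exists w.
have [_ [[w Aw <-] B'w]] := cly _ B' GA (open_nbhs_nbhs (conj oB' B'y)).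
by exists w; split=> //; exact: BB.
Qed.

Lemma measurable_linfZ d (T : measurableType d) (g : T -> borel V) :
  (forall n, measurable_fun setT (fun x => linfZ_val (g x) n)) -> measurable_fun setT g.
Proof.
move=> mg; apply: measurable_generated => B oB.
exact: (measurable_preimage_coordinates linfZ_coordinates).
Qed.

Lemma measurable_W0 d (T : measurableType d) (g : T -> borel W) :
  (forall n, measurable_fun setT (fun x => W0_val (g x) n)) -> measurable_fun setT g.
Proof.
move=> mg; apply: measurable_generated => B oB.
exact: (measurable_preimage_coordinates W0_coordinates).
Qed.

Lemma measurable_linfZ_W0 d (T : measurableType d) (g : T -> borel (V * W)%type) :
  (forall n, measurable_fun setT (fun x => linfZ_val (g x).1 n)) ->
  (forall n, measurable_fun setT (fun x => W0_val (g x).2 n)) -> measurable_fun setT g.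
Proof.
move=> mv mw.
have top := coordinate_topology_prod linfZ_coordinates W0_coordinates.
apply: measurable_generated => B oB.
by apply: (measurable_preimage_coordinates top) => // -[] n /=.
Qed.

Lemma measurable_linfZ_coord n : measurable_fun setT
  ((fun v => linfZ_val v n) : borel V -> R).
Proof.
apply: measurable_generated_real => B.
by move/continuousP: (@linfZ_coord_continuous n); apply.
Qed.

Lemma measurable_W0_coord n : measurable_fun setT
  ((fun w => W0_val w n) : borel W -> R).
Proof.
apply: measurable_generated_real => B.
by move/continuousP: (@W0_coord_continuous n); apply.
Qed.

Lemma measurable_fst_coord n : measurable_fun setT
  ((fun y => linfZ_val y.1 n) : borel (V * W)%type -> R).
Proof.
apply: measurable_generated_real => B; move: B; apply/continuousP => y.
apply: (@continuous_comp _ _ _ fst (fun v : V => linfZ_val v n)).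
  exact: cvg_fst.
exact: linfZ_coord_continuous.
Qed.

Lemma measurable_snd_coord n : measurable_fun setT
  ((fun y => W0_val y.2 n) : borel (V * W)%type -> R).
Proof.
apply: measurable_generated_real => B; move: B; apply/continuousP => y.
apply: (@continuous_comp _ _ _ snd (fun w : W => W0_val w n)).
  exact: cvg_snd.
exact: W0_coord_continuous.
Qed.

Lemma measurable_sigmaZ k : measurable_fun setT (sigmaZ k : borel V -> borel V).
Proof. by apply: measurable_linfZ => n; exact: measurable_linfZ_coord. Qed.

Lemma measurable_xibar beta k :
  measurable_fun setT ((fun v => xibar f beta v k) : borel V -> R).
Proof.
have mlim (t : V -> nat -> R) :
    (forall v, cvgn (series (t v))) ->
    (forall j, measurable_fun setT ((fun v => t v j) : borel V -> R)) ->
    measurable_fun setT ((fun v => limn (series (t v))) : borel V -> R).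
  move=> ct mt.
  apply: (@measurable_fun_cvg _ (borel V) R setT (fun m v => series (t v) m)).
    by move=> m; apply: measurable_sum => j; exact: mt.
  by move=> v _; exact: ct.
have mprod j c : measurable_fun setT ((fun v => linfZ_val v j * c) : borel V -> R).
  by apply: measurable_funM; [exact: measurable_linfZ_coord|exact: measurable_cst].
apply: measurable_funD; first by apply: (mlim (fun v => tm f beta v k)) => [v|j];
  [exact: tm_cvg|exact: mprod].
by apply: (mlim (fun v => tp f beta v k)) => [v|j]; [exact: tp_cvg|exact: mprod].
Qed.

Lemma measurable_dcocycle_coord beta k n :
  measurable_fun setT ((fun v => W0_val (dcocycle f0 beta k v) n) : borel V -> R).
Proof.
apply: measurable_funB; first exact: measurable_xibar.
exact: (measurableT_comp (measurable_xibar beta n) (measurable_sigmaZ k)).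
Qed.

Lemma measurable_dcocycle beta k :
  measurable_fun setT (dcocycle f0 beta k : borel V -> borel W).
Proof. by apply: measurable_W0 => n; exact: measurable_dcocycle_coord. Qed.

Lemma measurable_sigma_tilde beta :
  measurable_fun setT (sigma_tilde f0 beta : borel (V * W)%type -> borel (V * W)%type).
Proof.
have mfst : measurable_fun setT (fst : borel (V * W)%type -> borel V).
  by apply: measurable_linfZ => n; exact: measurable_fst_coord.
apply: measurable_linfZ_W0 => n; first exact: measurable_fst_coord.
apply: measurable_funD; first exact: measurable_snd_coord.
exact: (measurableT_comp (measurable_dcocycle_coord beta 1 n) mfst).
Qed.
End Spaces.

(** * Root coordinates of the cocycle *)

Section RootCoordinates.
Variables (R : realType) (f : {poly int}) (f0 : f`_0 != 0).
Local Notation C := R[i].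
Local Notation fC := (map_poly (fun c : int => c%:~R : C) f).
Local Notation lc := (lead_coef fC).
Variable beta : C -> C.
Hypothesis hbeta : partial_fractions f beta.

Lemma root_quo_root (z u : C) : Omega f z ->
  (u - z) * (root_quo f z).[u] = fC.[u].
Proof.
by rewrite /Omega /= (root_quo_eval f0) => /rootP ->; rewrite subr0.
Qed.

Lemma root_quoM (z : C) : Omega f z -> ('X - z%:P) * root_quo f z = fC.
Proof.
move=> Oz; apply/eqP; rewrite -subr_eq0; apply/eqP/poly_eval0 => u.
by rewrite hornerD hornerN hornerM hornerXsubC root_quo_root ?subrr.
Qed.

Lemma root_quo_distinct (z u : C) : Omega f z -> Omega f u -> u != z ->
  (root_quo f z).[u] = 0 :> C.
Proof.
move=> Oz; rewrite /Omega /= => /rootP fu uz; have := root_quo_root u Oz.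
by rewrite fu => /eqP; rewrite mulf_eq0 subr_eq0 (negbTE uz) => /eqP.
Qed.

(** The coefficient of the partial fraction at [z] is [lc / f' z]: evaluate at [z]
    the identity [root_quo_sum] between polynomials, in which only the quotient
    at [z] survives. *)
Lemma root_quo_residue (z : C) : Omega f z ->
  lc^-1 * beta z * (root_quo f z).[z] = 1 :> C.
Proof.
move=> Oz; have := congr1 (horner^~ z) (root_quo_sum f0 hbeta).
have zs : z \in fset_set (@Omega R f).
  by rewrite in_fset_set ?inE//; exact: Omega_finite.
rewrite hornerC horner_sum (big_fsetD1 z zs)/= hornerZ big1_seq ?addr0//.
move=> u; rewrite !inE => /andP[_ /andP[uz]].
rewrite in_fset_set ?inE; last exact: Omega_finite.
by move=> Ou; rewrite hornerZ root_quo_distinct ?mulr0// eq_sym.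
Qed.

Lemma conjc_int (n : int) : conjc (n%:~R : C) = n%:~R.
Proof. exact: rmorph_int. Qed.

Lemma Omega_conjc (z : C) : Omega f z -> Omega f (conjc z).
Proof.
rewrite /Omega /= => /rootP fz; apply/rootP.
transitivity (conjc fC.[z]); last by rewrite fz rmorph0.
rewrite !horner_fC rmorph_sum.
by apply: eq_bigr => j _; rewrite rmorphM rmorphXn /= conjc_int.
Qed.

Lemma nC_conjc (z : C) : nC (conjc z) = nC z.
Proof. by case: z => x y; rewrite /nC /= sqrrN. Qed.

Lemma Omega_0_conjc (z : C) : Omega_0 f z -> Omega_0 f (conjc z).
Proof. by case=> /Omega_conjc Oz z1; split=> //; rewrite nCE nC_conjc -nCE. Qed.

Lemma root_quo_conjc (z u : C) : (root_quo f (conjc z)).[conjc u] = conjc (root_quo f z).[u].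
Proof.
rewrite !horner_poly rmorph_sum; apply: eq_bigr => i _.
rewrite rmorphM rmorphXn; congr (_ * _); rewrite rmorph_sum.
by apply: eq_bigr => j _; rewrite rmorphM rmorphXn /= conjc_int.
Qed.

Lemma residue_conjc (z : C) : Omega f z ->
  lc^-1 * beta (conjc z) = conjc (lc^-1 * beta z).
Proof.
move=> Oz; have := root_quo_residue (Omega_conjc Oz).
have := congr1 conjc (root_quo_residue Oz).
rewrite rmorphM rmorph1 root_quo_conjc => h1 h2.
apply: (mulIf _ (etrans h2 (esym h1))); apply/eqP => q0.
by have /eqP := root_quo_residue Oz; rewrite -[_.[z]]conjcK q0 rmorph0 mulr0 eq_sym oner_eq0.
Qed.

(** Roots of modulus one come in conjugate pairs with conjugate coefficients. *)
Lemma root_sum_real n :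
  ((complex.Re (root_sum f beta (@Omega_0 R f) n))%:C)%C = root_sum f beta (@Omega_0 R f) n.
Proof.
have O0 := sub_finite_set (@sub_0 R f) (Omega_finite R f0).
suff : conjc (root_sum f beta (@Omega_0 R f) n) = root_sum f beta (@Omega_0 R f) n.
  case: (root_sum _ _ _ _) => x y [/eqP]; rewrite -subr_eq0 -opprD oppr_eq0.
  by rewrite -mulr2n mulrn_eq0 => /eqP ->.
have lc_real : conjc lc^-1 = lc^-1.
  by rewrite conjc_inv /lead_coef coef_fC conjc_int.
have bij : set_bij (@Omega_0 R f) (@Omega_0 R f) conjc.
  split=> [z|u v _ _|z /Omega_0_conjc Oz]; first exact: Omega_0_conjc.
    exact: (can_inj (@conjcK R)).
  by exists (conjc z) => //; rewrite conjcK.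
have E : root_sum f beta (@Omega_0 R f) n =
    \sum_(z \in @Omega_0 R f) lc^-1 * beta z * z ^ (n - 1).
  by rewrite (root_sumE f0) ?fsbig_finite//; exact: sub_0.
rewrite E [RHS](reindex_fsbig conjc _ _ _ bij) !fsbig_finite// rmorph_sum.
rewrite !big_seq; apply: eq_bigr => z; rewrite in_fset_set// inE => -[Oz _].
by rewrite rmorphM residue_conjc// fmorphXz.
Qed.

(** The value at time 0 of the sequence f/(u - z) applied to [w], with u acting as
    the shift. *)
Definition root_coord z (w : {ptws int -> R}) : C :=
  \sum_(i < size f) (root_quo f z)`_i * (w i%:Z)%:C%C.

Lemma root_coordD z : {morph root_coord z : x y / x + y}.
Proof.
move=> x y; rewrite /root_coord -big_split; apply: eq_bigr => i _ /=.
by rewrite -mulrDr -rmorphD.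
Qed.

(** The operator u - z kills f/(u - z) applied to [w], as f does [w]. *)
Lemma root_coord_shift z w : Omega f z -> w \in @W0_pred R f ->
  root_coord z (sigma 1 w) = z * root_coord z w.
Proof.
move=> Oz /asboolP[_ /(congr1 (fun y => y 0)) fw].
pose h := root_quo f z.
have fw0 : \sum_(i < size f) fC`_i * (w i%:Z)%:C%C = 0.
  transitivity ((\sum_(i < size f) w (0 + i%:Z) *~ f`_i)%:C%C : C).
    rewrite rmorph_sum.
    by apply: eq_bigr => i _; rewrite coef_fC rmorphMz /= add0r mulrzl.
  by rewrite -[X in X%:C%C]/(f_sigma f w 0) fw.
have shift : \sum_(i < size f) ('X * h)`_i * (w i%:Z)%:C%C = root_coord z (sigma 1 w).
  rewrite /root_coord -/h; case sz : (size f) => [|n]; first by rewrite !big_ord0.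
  have hn0 : h`_n = 0.
    rewrite coef_poly; case: ifP => // _; apply: big_pred0 => j.
    by have := ltn_ord j; rewrite [X in (_ < X)%N]sz; lia.
  rewrite big_ord_recl coefXM mul0r add0r [RHS]big_ord_recr /= hn0 mul0r addr0.
  by apply: eq_bigr => i _; rewrite coefXM /= /sigma /bump /= add1n -addn1 PoszD.
apply/eqP; rewrite -subr_eq0 -shift; apply/eqP; rewrite -[RHS]fw0 -(root_quoM Oz) -/h.
rewrite /root_coord mulr_sumr -sumrB; apply: eq_bigr => i _.
by rewrite mulrBl coefB coefCM mulrBl mulrA.
Qed.

(** The sequence is the one which the cocycle adds at each step, scaled by an
    entry of [v]; by [root_quo_residue] its component at each root is
    normalised. *)
Lemma root_coord_step z : Omega_0 f z ->
  root_coord z (fun k => complex.Re (root_sum f beta (@Omega_0 R f) (k + 1))) = 1.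
Proof.
move=> z0; have [Oz _] := z0; rewrite /root_coord.
under eq_bigr do rewrite root_sum_real (root_sumE f0 _ _ (@sub_0 R f)) mulr_sumr.
rewrite exchange_big /=.
have zs : z \in fset_set (@Omega_0 R f).
  by rewrite in_fset_set ?inE//; exact: sub_finite_set (@sub_0 R f) (Omega_finite R f0).
have quoE u : \sum_(i < size f) (root_quo f z)`_i * (lc^-1 * beta u * u ^ (i%:Z + 1 - 1)) =
   lc^-1 * beta u * (root_quo f z).[u].
  rewrite (horner_coef_wide _ (size_poly _ _)) mulr_sumr.
  by apply: eq_bigr => i _; rewrite addrK -exprnP mulrCA.
rewrite (big_fsetD1 z zs)/= quoE root_quo_residue// big1_seq ?addr0//.
move=> u; rewrite !inE => /andP[_ /andP[uz]].
rewrite in_fset_set ?inE; last exact: sub_finite_set (@sub_0 R f) (Omega_finite R f0).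
by move=> [Ou _]; rewrite quoE root_quo_distinct ?mulr0.
Qed.
End RootCoordinates.

(** * Lifts, tightness and coboundaries *)

Lemma measure_ae_eq d (T : measurableType d) (R : realType) (P : probability T R)
    (A B : set T) : measurable A -> measurable B ->
  {ae P, forall x, A x <-> B x} -> P A = P B.
Proof.
move=> mA mB [N [mN PN0 hN]].
have le (A' B' : set T) : measurable A' -> measurable B' ->
    (forall x, ~ N x -> A' x -> B' x) -> (P A' <= P B')%E.
  move=> mA' mB' AB'; rewrite -[leRHS]adde0 -PN0.
  apply: le_trans (measureU2 _ mB' mN); apply: le_measure; rewrite ?inE//.
    exact: measurableU.
  by move=> x A'x; have [Nx|nNx] := pselect (N x); [right|left; exact: AB'].
have AB x : ~ N x -> (A x <-> B x).
  by move=> nNx; apply: contrapT => nAB; apply: nNx; exact: hN.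
by apply/eqP; rewrite eq_le !le// => x /AB[].
Qed.

Lemma probability_setI_gt d (T : measurableType d) (R : realType)
    (P : probability T R) (A B : set T) (r s : R) : measurable A -> measurable B ->
  (r%:E < P A)%E -> (s%:E < P B)%E -> ((r + s - 1)%:E < P (A `&` B))%E.
Proof.
move=> mA mB; have fin X : measurable X -> P X = (fine (P X))%:E.
  by move=> mX; rewrite fineK ?fin_num_measure.
have AB : (P A <= P (A `&` B) + P (~` B))%E.
  rewrite (measureDI P mA mB) addeC leeD2l// le_measure ?inE//.
  - exact: measurableD.
  - exact: measurableC.
move: AB; rewrite probability_setC// (fin A)// (fin B)// (fin (A `&` B)).
  by rewrite -EFinB -EFinD !lee_fin !lte_fin; lra.
exact: measurableI.
Qed.

Lemma measurable_le_norm d (T : measurableType d) (R : realType) (g : T -> R) (M : R) :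
  measurable_fun setT g -> measurable [set x | `|g x| <= M].
Proof.
move=> mg; have := measurable_fun_ler (measurableT_comp (@normr_measurable R setT) mg)
  (@measurable_cst _ _ T R setT M).
by move=> /(_ measurableT [set true] I); rewrite setTI.
Qed.

Section Equivalence.
Variables (R : realType) (f : {poly int}) (f0 : f`_0 != 0).
Local Notation C := R[i].
Local Notation V := (linfZ R).
Local Notation W := (W0 R f).
Variables (beta : C -> C) (nu : probability (borel V) R).
Hypothesis nu_inv : measure_invariant nu (sigmaZ 1).
Local Notation d := (dcocycle f0 beta).
Local Notation st := (sigma_tilde f0 beta).

(** The image of [nu] on the graph of [b], which is invariant as
    [sigma_tilde (v, b v) = (sigmaZ 1 v, b (sigmaZ 1 v))]. *)
Lemma coboundary_lift (b : V -> W) :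
  measurable_fun setT (b : borel V -> borel W) ->
  {ae nu, forall v, d 1 v = b (sigmaZ 1 v) - sigmaW 1 (b v)} ->
  exists nut : probability (borel (V * W)%type) R,
    measure_invariant nut st /\ pushes_to nut nu fst.
Proof.
move=> mb hb; pose graph (v : V) : V * W := (v, b v).
have mgraph : measurable_fun setT (graph : borel V -> borel (V * W)%type).
  apply: measurable_linfZ_W0 => n; first exact: measurable_linfZ_coord.
  exact: (@measurableT_comp _ _ _ (borel V) (borel W) R (fun w : W => W0_val w n)
    setT b (measurable_W0_coord n) mb).
have [nut nutE] := pushforward_probability nu mgraph.
exists nut; split=> A mA; last by rewrite nutE.
rewrite !nutE -[in RHS](nu_inv); last by rewrite -[_ @^-1` _]setTI; exact: mgraph.
apply: measure_ae_eq.
- rewrite -[X in measurable X]setTI; apply: mgraph => //.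
  by rewrite -[_ @^-1` _]setTI; exact: measurable_sigma_tilde.
- rewrite -[X in measurable X]setTI; apply: (measurable_sigmaZ 1) => //.
  by rewrite -[_ @^-1` _]setTI; exact: mgraph.
apply: (@filterS _ _ (ae_filter_ringOfSetsType nu) _ _ _ hb) => v hv.
by rewrite /preimage /= /graph /sigma_tilde /= hv addrC subrK.
Qed.

Lemma iter_sigmaZ k (v : V) : iter k (sigmaZ 1) v = sigmaZ k%:Z v.
Proof.
elim: k => [|k IH]; first by rewrite sigmaZ0.
by rewrite iterS IH sigmaZA -addn1 PoszD addrC.
Qed.

Lemma iter_sigma_tilde k v w :
  iter k st (v, w) = (sigmaZ k%:Z v, sigmaW k%:Z w + d k%:Z v).
Proof.
elim: k => [|k IH].
  rewrite /= sigmaZ0; congr (_, _); apply/val_inj/funext => n.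
  rewrite [RHS](_ : _ = W0_val w (n + 0) + d_seq f beta 0 v n)//.
  by rewrite d_seq0 addr0 [n + 0]addr0.
rewrite iterS IH /sigma_tilde /= sigmaZA -PoszD add1n; congr (_, _).
apply/val_inj/funext => n.
have := congr1 (fun y => y n) (d_seqD f beta k%:Z 1 v).
rewrite -[k.+1]addn1 PoszD => dE.
rewrite [RHS](_ : _ = W0_val w (n + (k%:Z + 1)) + d_seq f beta (k%:Z + 1) v n)// dE.
rewrite [LHS](_ : _ = W0_val w (n + 1 + k%:Z) + d_seq f beta k%:Z v (n + 1)
   + d_seq f beta 1 (sigmaZ k%:Z v) n)//.
have -> : n + 1 + k%:Z = n + (k%:Z + 1) by rewrite [k%:Z + 1]addrC addrA.
exact: (esym (addrA _ _ _)).
Qed.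

Lemma sigmaZ_inv (k : int) (A : set V) : measurable (A : set (borel V)) ->
  nu (sigmaZ k @^-1` A) = nu A.
Proof.
have pos (j : nat) B : measurable (B : set (borel V)) -> nu (sigmaZ j%:Z @^-1` B) = nu B.
  move=> mB; rewrite -[RHS](iter_inv (measurable_sigmaZ 1) nu_inv j)//.
  by congr (nu _); apply/funext => v; rewrite /preimage/= iter_sigmaZ.
case: k => k mA; first exact: pos.
rewrite NegzE -[LHS](pos k.+1); last first.
  by rewrite -[_ @^-1` _]setTI; exact: measurable_sigmaZ.
congr (nu _); apply/funext => v; rewrite /preimage/= sigmaZA addNr sigmaZ0 //.
Qed.

Lemma measurable_W0_ball M : measurable (W0_ball M : set (borel W)).
Proof.
by apply: measurable_forall => n; apply: measurable_le_norm; exact: measurable_W0_coord.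
Qed.

(** The cocycle identity between the times [- k] and [k], which sum to 0. *)
Lemma dcocycle_ball_opp (k : nat) M v :
  W0_ball M (d (- k%:Z) v) <-> W0_ball M (d k%:Z (sigmaZ (- k%:Z) v)).
Proof.
have := d_seqD f beta (- k%:Z) k%:Z v; rewrite addNr d_seq0 => dE.
have E n : W0_val (d k%:Z (sigmaZ (- k%:Z) v)) n = - W0_val (d (- k%:Z) v) (n + k%:Z).
  apply/eqP; rewrite -addr_eq0 addrC; apply/eqP.
  exact: (esym (congr1 (fun y => y n) dE)).
split=> h n; first by rewrite E normrN; exact: h.
by rewrite -[n](subrK k%:Z) -normrN -E; exact: h.
Qed.

(** If [w] and the second coordinate of [iter k sigma_tilde (v, w)] lie in the ball
    of radius [n], then the cocycle at time [k] lies in the ball of radius [2n].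
    Both events have probability more than [1 - eps / 2] for a large [n], by
    invariance and because the elements of [W0] are bounded.  Negative times
    follow by the invariance of [nu]. *)
Lemma lift_tight (nut : probability (borel (V * W)%type) R) :
  measure_invariant nut st -> pushes_to nut nu fst ->
  forall eps : R, 0 < eps -> exists2 K : set W, compact K &
    forall k : int, ((1 - eps)%:E < nu [set v | K (d k v)])%E.
Proof.
move=> nut_inv nut_nu eps eps0.
pose B (n : nat) : set (borel (V * W)%type) := [set y | W0_ball n%:R y.2].
have mB n : measurable (B n).
  apply: measurable_forall => j; apply: measurable_le_norm.
  exact: measurable_snd_coord.
have ndB : nondecreasing_seq B.
  move=> m n mn; apply/subsetPset => y hy j; apply: le_trans (hy j) _.
  by rewrite ler_nat.
have BT : \bigcup_n B n = setT.
  apply/seteqP; split=> // y _.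
  have /asboolP[[M hM] _] := W0P y.2.
  exists (Num.truncn M).+1 => // j.
  exact: le_trans (hM j) (ltW (truncnS_gt _)).
have cvgB : nut \o B @ \oo --> 1%E.
  have <- : nut (\bigcup_n B n) = 1%E by rewrite BT; exact: probability_setT.
  exact: nondecreasing_cvg_mu mB (bigcupT_measurable _ mB) ndB.
have [n large] : exists n, ((1 - eps / 2)%:E < nut (B n))%E.
  apply: contrapT => small.
  have : (1 <= (1 - eps / 2)%:E :> \bar R)%E.
    rewrite -(cvg_lim _ cvgB)//; apply: lime_le; first by apply/cvg_ex; exists 1%E.
    apply: nearW => n /=; rewrite leNgt; apply/negP => large.
    by apply: small; exists n.
  by rewrite lee_fin; lra.
exists (W0_ball (n%:R + n%:R)); first exact: compact_W0_ball.
have md k : measurable ([set v | W0_ball (n%:R + n%:R) (d k v)] : set (borel V)).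
  rewrite -[X in measurable X]setTI; apply: (measurable_dcocycle f0 beta k) => //.
  exact: measurable_W0_ball.
have pos (k : nat) : ((1 - eps)%:E < nu [set v | W0_ball (n%:R + n%:R) (d k%:Z v)])%E.
  rewrite nut_nu//.
  have mBk : measurable (iter k st @^-1` B n : set (borel (V * W)%type)).
    rewrite -[X in measurable X]setTI.
    exact: (measurable_iter (measurable_sigma_tilde f0 beta) k).
  have large_k : ((1 - eps / 2)%:E < nut (iter k st @^-1` B n))%E.
    by rewrite (iter_inv (measurable_sigma_tilde f0 beta) nut_inv).
  have := probability_setI_gt (mB n) mBk large large_k.
  rewrite (_ : 1 - eps / 2 + (1 - eps / 2) - 1 = 1 - eps); last by lra.
  move=> /lt_le_trans; apply; apply: le_measure; rewrite ?inE//.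
  - exact: measurableI.
  - rewrite -[X in measurable X]setTI.
    have mfst : measurable_fun setT (fst : borel (V * W)%type -> borel V).
      by apply: measurable_linfZ => j; exact: measurable_fst_coord.
    exact: mfst.
  move=> [v w] [/= hw]; rewrite iter_sigma_tilde => hk j /=.
  have := hk j; rewrite /= => hkj; have := hw (j + k%:Z) => /= hwj.
  rewrite -[X in `|X|](addKr (W0_val w (j + k%:Z))).
  rewrite addrC (le_trans (ler_normB _ _))// lerD//.
case=> k; first exact: pos.
rewrite NegzE; apply: (lt_le_trans (pos k.+1)).
rewrite -(@sigmaZ_inv (- k.+1%:Z) _ (md _)); apply: le_measure; rewrite ?inE.
- by rewrite -[X in measurable X]setTI; apply: measurable_sigmaZ => //; exact: md.
- exact: md.
- by move=> v hv; apply/dcocycle_ball_opp.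
Qed.

Lemma compact_root_coord_bounded (K : set W) (z : C) : compact K ->
  exists M : R, forall w, K w -> nC (root_coord f z (W0_val w)) <= M.
Proof.
move=> cK.
have bd (n : int) : exists M : R, forall w, K w -> `|W0_val w n| <= M.
  have /compact_bounded[M [_ hM]] : compact ((fun w => W0_val w n) @` K).
    apply: continuous_compact => //; apply: continuous_subspaceT.
    exact: W0_coord_continuous.
  exists (M + 1) => w Kw; apply: (hM (M + 1)); first by rewrite ltrDl.
  by exists w.
have [M hM] := choice bd.
exists (\sum_(i < size f) nC (root_quo f z)`_i * M i%:Z) => w Kw.
apply: (le_trans (nC_sum _)); apply: ler_sum => i _.
rewrite nCM ler_wpM2l ?nC_ge0// (_ : nC _ = `|W0_val w i%:Z|) ?hM//.
by rewrite /nC /= expr0n addr0 sqrtr_sqr.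
Qed.

Hypothesis hbeta : partial_fractions f beta.

(** The root coordinate of the cocycle satisfies the recurrence
    [x_(n + 1) = z * x_n + v_n]. *)
Lemma root_coord_dcocycle z (n : nat) v : Omega_0 f z ->
  nC (root_coord f z (W0_val (d n%:Z v))) =
  nC (twisted_sum (sigmaZ 1) (fun v : V => linfZ_val v 0) z n v).
Proof.
move=> z0; have [Oz z1] := z0.
have zn0 : z != 0 := Omega_neq0 f0 Oz.
suff -> : root_coord f z (W0_val (d n%:Z v)) =
    z ^+ n * twisted_sum (sigmaZ 1) (fun v : V => linfZ_val v 0) z n v.
  rewrite nCM nCX (_ : nC z = 1) ?expr1n ?mul1r//.
  by move: z1; rewrite nCE => -[].
elim: n => [|n IH].
  rewrite /twisted_sum big_ord0 mulr0 /root_coord big1// => i _.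
  by rewrite [W0_val _ _](_ : _ = d_seq f beta 0 v i%:Z)// d_seq0 mulr0.
have -> : W0_val (d n.+1%:Z v) =
    sigma 1 (W0_val (d n%:Z v)) + W0_val (d 1 (sigmaZ n%:Z v)).
  by rewrite -addn1 PoszD; exact: d_seqD.
rewrite root_coordD (root_coord_shift f0 Oz (W0P _)) IH.
rewrite /twisted_sum big_ord_recr mulrDr; congr (_ + _); first by rewrite exprS mulrA.
rewrite iter_sigmaZ exprVn mulVKf; last by rewrite expf_neq0.
have -> : root_coord f z (W0_val (d 1 (sigmaZ n%:Z v))) =
    (linfZ_val v n%:Z)%:C%C *
    root_coord f z (fun k => complex.Re (root_sum f beta (@Omega_0 R f) (k + 1))).
  rewrite /root_coord mulr_sumr; apply: eq_bigr => i _.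
  rewrite [W0_val _ _](_ : _ = xibar f beta (sigmaZ n%:Z v) (i%:Z + 1)
    - xibar f beta (sigmaZ 1 (sigmaZ n%:Z v)) i%:Z)//.
  rewrite (xibar_sigma1 f0) (_ : linfZ_val (sigmaZ n%:Z v) 0 = linfZ_val v n%:Z).
    by rewrite rmorphM mulrCA.
  by rewrite -[LHS]/(linfZ_val v (0 + n%:Z)) add0r.
rewrite (root_coord_step f0 hbeta z0) mulr1.
by rewrite -[RHS]/((linfZ_val v (0 + n%:Z))%:C%C) add0r.
Qed.

(** Each root [z] of modulus one has a transfer function [B z]; the step of the
    cocycle being the real part of the combination of progressions with
    coefficients [beta], the one with coefficients [beta z * B z v] is the
    transfer function that we want. *)
Lemma tight_coboundary :
  (forall eps : R, 0 < eps -> exists2 K : set W, compact K &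
    forall k : int, ((1 - eps)%:E < nu [set v | K (d k v)])%E) ->
  exists b : V -> W, measurable_fun setT (b : borel V -> borel W) /\
    {ae nu, forall v, d 1 v = b (sigmaZ 1 v) - sigmaW 1 (b v)}.
Proof.
move=> tight.
have ex z : exists B : V -> C, Omega_0 f z ->
    measurable_complex (B : borel V -> C) /\
    {ae nu, forall v, (linfZ_val v 0)%:C%C = B (sigmaZ 1 v) - z * B v}.
  have [z0|nz0] := pselect (Omega_0 f z); last by exists (fun=> 0).
  have [Oz z1] := z0; have w1 : nC z = 1 by move: z1; rewrite nCE => -[].
  have [|B [mB hB]] := tight_twisted_coboundary (measurable_sigmaZ 1) nu_inv
     (measurable_linfZ_coord 0) w1; last by exists B.
  move=> eps eps0; have [K cK large] := tight _ eps0.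
  have [M hM] := compact_root_coord_bounded z cK.
  have mK n : measurable ([set v | K (d n%:Z v)] : set (borel V)).
    rewrite -[X in measurable X]setTI; apply: (measurable_dcocycle f0 beta n%:Z) => //.
    rewrite -[K]setCK; apply: measurableC; apply: sub_sigma_algebra.
    by apply: closed_openC; exact: compact_closed (@W0_hausdorff R f) cK.
  exists M => n; apply: (@le_trans _ _ (nu (~` [set v | K (d n%:Z v)]))).
    apply: le_measure; rewrite ?inE.
    - apply: measurable_lt_nC; apply: measurable_twisted_sum.
        exact: measurable_sigmaZ.
      exact: measurable_linfZ_coord.
    - by apply: measurableC; exact: mK.
    - move=> v /= out Kv; have := hM _ Kv.
      by rewrite root_coord_dcocycle// leNgt out.
  rewrite probability_setC; last exact: mK.
  have := large n%:Z; rewrite -[nu [set v | _]](fineK (fin_num_measure nu _ (mK n))).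
  by rewrite -EFinB lte_fin lee_fin; lra.
have [B hB] := choice ex.
pose bs v : {ptws int -> R} := fun k => complex.Re
  (root_sum f (fun z => beta z * B z v) (@Omega_0 R f) (k + 1)).
have bW v : bs v \in @W0_pred R f := root_sum0_W0 f0 (fun z => beta z * B z v).
have fin0 := sub_finite_set (@sub_0 R f) (Omega_finite R f0).
exists (fun v => MkW0 (bW v)); split.
  apply: measurable_W0 => n.
  pose term z v : C := if pselect (Omega_0 f z) then
    (lead_coef (map_poly (fun c : int => c%:~R : C) f))^-1 * (beta z * B z v)
      * z ^ (n + 1 - 1) else 0.
  have msum : measurable_complex
      ((fun v => \sum_(z <- fset_set (@Omega_0 R f)) term z v) : borel V -> C).
    apply: measurable_complex_sum => z; rewrite /term.
    case: pselect => z0; last exact: measurable_complex_cst.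
    apply: measurable_complexM; last exact: measurable_complex_cst.
    apply: measurable_complexM; first exact: measurable_complex_cst.
    apply: measurable_complexM; first exact: measurable_complex_cst.
    by have [] := hB z z0.
  rewrite (_ : (fun _ => _) = (fun v =>
    complex.Re (\sum_(z <- fset_set (@Omega_0 R f)) term z v))); first exact: msum.1.
  apply/funext => v; rewrite /= /bs (root_sumE f0); last exact: sub_0.
  congr complex.Re; rewrite !big_seq; apply: eq_bigr => z.
  by rewrite in_fset_set// inE /term => z0; case: pselect.
have : {ae nu, forall v, forall z, Omega_0 f z ->
    (linfZ_val v 0)%:C%C = B z (sigmaZ 1 v) - z * B z v}.
  have := @filter_bigI _ _ (fset_set (@Omega_0 R f))
    (fun z => [set v | (linfZ_val v 0)%:C%C = B z (sigmaZ 1 v) - z * B z v])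
    _ (ae_filter_ringOfSetsType nu).
  move=> bigI; apply: (@filterS _ _ (ae_filter_ringOfSetsType nu) _ _ _ (bigI _)).
    by move=> v hv z z0; apply: hv; rewrite /= in_fset_set// inE.
  by move=> z; rewrite in_fset_set// inE => /hB[].
apply: (@filterS _ _ (ae_filter_ringOfSetsType nu)) => v hv.
apply/val_inj/funext => k.
rewrite [LHS](_ : _ = xibar f beta v (k + 1) - xibar f beta (sigmaZ 1 v) k)//.
rewrite (xibar_sigma1 f0).
rewrite [RHS](_ : _ = bs (sigmaZ 1 v) k - bs v (k + 1))// /bs -raddfB.
transitivity (complex.Re ((linfZ_val v 0)%:C%C * root_sum f beta (@Omega_0 R f) (k + 1))).
  by case: (root_sum _ _ _ _) => x y; rewrite /= mul0r subr0.
congr complex.Re; rewrite !(root_sumE f0 _ _ (@sub_0 R f)) mulr_sumr -sumrB.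
rewrite !big_seq; apply: eq_bigr => z; rewrite in_fset_set// inE => z0.
have zn0 := Omega_neq0 f0 z0.1.
rewrite (hv z z0) !addrK expfzDr// expr1z.
by ring.
Qed.

End Equivalence.

(** * The equivariant coding map *)

Lemma continuous_ptws (X Y : topologicalType) (J : Type) (g : X -> {ptws J -> Y}) :
  (forall j, continuous (fun x => g x j)) -> continuous g.
Proof.
move=> cg x.
have FF : Filter (g @ x) by exact: fmap_filter.
suff : (g @ x) --> g x by [].
apply/cvg_sup => j A; rewrite nbhsE => -[_ [[B oB <-] Bx] BA].
have nB : nbhs x ((fun x => g x j) @^-1` B).
  exact: (cg j x _ (open_nbhs_nbhs (conj oB Bx))).
suff : nbhs x (g @^-1` A) by [].
by apply: filterS nB => q Bq; exact: BA.
Qed.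

Section EquivariantCoding.
Variables (R : realType) (f : {poly int}) (f0 : f`_0 != 0).
Variables (beta : R[i] -> R[i]) (hbeta : partial_fractions f beta).
Local Notation V := (linfZ R).
Local Notation W := (W0 R f).

Lemma rhoD (x y : {ptws int -> R}) : rho (x + y) = rho x + rho y.
Proof.
apply/funext => n.
exact: (raddfD (\pi_(circle R)%qT : {additive R -> circle R}) (x n) (y n)).
Qed.

Lemma rho_continuous : continuous (@rho R).
Proof.
apply: continuous_ptws => n y.
apply: (@continuous_comp _ _ _ (fun y : {ptws int -> R} => y n)
  (fun x : R => \pi_(circle R)%qT x)).
  exact: ptws_coord_continuous.
exact: pi_continuous.
Qed.

Lemma X_val_coding (b : V -> W) v :
  X_val (xi f0 hbeta v + rhoW (b v)) = rho (xibar f beta v + W0_val (b v)).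
Proof. by rewrite rhoD. Qed.

Lemma measurable_coding (b : V -> W) :
  measurable_fun setT (b : borel V -> borel W) ->
  measurable_fun setT
    ((fun v => xi f0 hbeta v + rhoW (b v)) : borel V -> borel (X R f)).
Proof.
move=> mb; apply: measurable_generated => _ [B oB <-].
rewrite [X in measurable X](_ : _ =
    (fun v => xibar f beta v + W0_val (b v)) @^-1` (@rho R @^-1` B)); last first.
  by apply/funext => v; rewrite /preimage /= -X_val_coding.
apply: (measurable_preimage_coordinates (@coordinate_topology_ptws R int)).
  move=> n; apply: measurable_funD; first exact: measurable_xibar.
  exact: (@measurableT_comp _ _ _ (borel V) (borel W) R (fun w : W => W0_val w n)
    setT b (measurable_W0_coord n) mb).
by move/continuousP: rho_continuous; apply.
Qed.

(** Both sides are the reductions of sequences which are equal, as the cocycle is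
    exactly the defect of equivariance of [xibar]. *)
Lemma coding_equivariant (b : V -> W) v :
  dcocycle f0 beta 1 v = b (sigmaZ 1 v) - sigmaW 1 (b v) ->
  xi f0 hbeta (sigmaZ 1 v) + rhoW (b (sigmaZ 1 v)) =
  alpha (xi f0 hbeta v + rhoW (b v)).
Proof.
move=> hv; apply: val_inj; rewrite [LHS]X_val_coding.
rewrite [RHS](_ : _ = sigma 1 (rho (xibar f beta v + W0_val (b v)))); last first.
  by rewrite -X_val_coding.
have -> : W0_val (b (sigmaZ 1 v)) =
    sigma 1 (xibar f beta v) - xibar f beta (sigmaZ 1 v) + sigma 1 (W0_val (b v)).
  have -> : b (sigmaZ 1 v) = dcocycle f0 beta 1 v + sigmaW 1 (b v).
    by rewrite hv subrK.
  by [].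
transitivity (rho (sigma 1 (xibar f beta v) + sigma 1 (W0_val (b v)))) => //.
by congr rho; rewrite addrA [xibar _ _ _ + _]addrC subrK.
Qed.

Lemma measurable_alpha : measurable_fun setT (@alpha R f : borel (X R f) -> borel (X R f)).
Proof.
apply: measurable_generated => _ [B oB <-]; apply: sub_sigma_algebra.
exists (@sigma (circle R) 1 @^-1` B) => //.
suff : continuous (@sigma (circle R) 1) by move=> /continuousP; apply.
by apply: continuous_ptws => n; exact: ptws_coord_continuous.
Qed.
End EquivariantCoding.

Unset Implicit Arguments.

Theorem theorem4p13 (R : realType) (f : {poly int})
  (f0 : f`_0 != 0) (f_deg : (1 < size f)%N) (f_lead : 0 < lead_coef f)
  (f_irr : laurent_irreducible (tofrac f))
  (f_nonhyp : nonhyperbolic R f) (f_ncyc : ~ cyclotomic R f)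
  (beta : R[i] -> R[i]) (hbeta : partial_fractions f beta)
  (nu : probability (borel (linfZ R)) R)
  (nu_inv : measure_invariant nu (sigmaZ 1)) :
  let d := dcocycle f0 beta in
  let cond1 :=
    exists nut : probability (borel (linfZ R * W0 R f)%type) R,
      measure_invariant nut (sigma_tilde f0 beta) /\
      pushes_to nut nu fst in
  let cond2 :=
    forall eps : R, 0 < eps ->
      exists2 C : set (W0 R f), compact C &
        forall k : int, ((1 - eps)%:E < nu [set v | C (d k v)])%E in
  let is_b (b : linfZ R -> W0 R f) :=
    measurable_fun setT (b : borel (linfZ R) -> borel (W0 R f)) /\
    {ae nu, forall v, d 1 v = b (sigmaZ 1 v) - sigmaW 1 (b v)} in
  let cond3 := exists b, is_b b in
  [/\ cond1 <-> cond2,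
      cond2 <-> cond3
    & forall b, is_b b ->
        let xi_b := fun v => xi f0 hbeta v + rhoW (b v) in
        [/\ measurable_fun setT (xi_b : borel (linfZ R) -> borel (X R f)),
            forall v, X0 (xi_b v - xi f0 hbeta v),
            {ae nu, forall v, xi_b (sigmaZ 1 v) = alpha (xi_b v)}
          & exists mu : probability (borel (X R f)) R,
              pushes_to nu mu xi_b /\ measure_invariant mu (@alpha R f)]].
Proof.
move=> d cond1 cond2 is_b cond3.
have c12 : cond1 -> cond2 by move=> [nut [inv pushes]]; exact: lift_tight inv pushes.
have c23 : cond2 -> cond3 by move=> tight; exact: tight_coboundary hbeta tight.
have c31 : cond3 -> cond1 by move=> [b [mb hb]]; exact: coboundary_lift mb hb.
split; [by split=> [/c12|/c23/c31]|by split=> [/c23|/c31/c12]|].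
move=> b [mb hb] xi_b.
have mxi : measurable_fun setT (xi_b : borel (linfZ R) -> borel (X R f)).
  exact: measurable_coding.
have equi : {ae nu, forall v, xi_b (sigmaZ 1 v) = alpha (xi_b v)}.
  apply: (@filterS _ _ (ae_filter_ringOfSetsType nu) _ _ _ hb) => v hv.
  exact: coding_equivariant.
split=> //.
  by move=> v; exists (b v) => //; rewrite /xi_b addrC addKr.
have [mu muE] := pushforward_probability nu mxi.
exists mu; split=> A mA; first by rewrite muE.
have mxiA B : measurable (B : set (borel (X R f))) ->
    measurable (xi_b @^-1` B : set (borel (linfZ R))).
  by move=> mB; rewrite -[_ @^-1` _]setTI; exact: mxi.
rewrite !muE -[RHS]nu_inv; last exact: mxiA.
apply: measure_ae_eq.
- apply: mxiA; rewrite -[_ @^-1` _]setTI; exact: measurable_alpha.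
- by rewrite -[_ @^-1` _]setTI; apply: (measurable_sigmaZ 1) => //; exact: mxiA.
by apply: (@filterS _ _ (ae_filter_ringOfSetsType nu) _ _ _ equi) => v; rewrite /preimage /= => ->.
Qed.
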